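(* Let $\mathcal M$ be the set of Morse-like functions on $[0,1]$ with local minima at $x=0$ and $x=1$, modulo graph-equivalence, and let $\mathcal X$ be the set of isomorphism classes of chiral merge trees. If $B=\{I_j\}_{j=1}^N$ is a barcode where $I_1=[b_1,\infty)$, $I_j=[b_j,d_j)\subset I_1$ with $d_j>d_{j+1}$ for all $j\ge 2$, and where every left-hand endpoint $b_j$ is distinct, then the number of graph-equivalence classes of functions in $\mathcal M$ realizing $B$ is $$|PH_0^{-1}(B)| = 2^{N-1}\prod_{j=2}^N \mu_B(I_j).$$ Here $\mu_B(I_j):=|\{I_k\in B \mid I_j\subsetneq I_k\}|$, and $PH_0$ is identified with the composition of $\Psi:\mathcal M\to\mathcal X$ followed by the Chiral Elder map $\Xi_{\mathcal X}:\mathcal X\to\mathcal B$.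
   Context: **Barcodes.** A barcode is a multiset of intervals of $\mathbb{R}$, each with finite multiplicity; $\mathcal{B}$ is the set of all barcodes. **Functions.** Two continuous $f,g:[0,1]\to\mathbb{R}$ are graph-equivalent if there is an orientation-preserving homeomorphism $\phi:[0,1]\to[0,1]$ with $f=g\circ\phi$. A critical point of $f$ is a point $p\in[0,1]$ that is a local minimum or a local maximum, i.e. there is an open neighborhood $U$ of $p$ in $[0,1]$ with $f(p)\le f(x)$ for all $x\in U$, or $f(x)\le f(p)$ for all $x\in U$. A continuous $f$ is Morse-like if it is graph-equivalent to a piecewise-linear function in which every critical point is isolated and has a distinct critical value (so its graph consists of finitely many segments, each of nonzero slope). **Merge trees.** A merge tree is a connected, locally finite, contractible one-dimensional cell complex $T$ with a distinguished edge $e_\infty$ without compact closure, such that $T\setminus e_\infty$ is a compact tree rooted at $v_\infty$, the one vertex incident to $e_\infty$, together with a continuous map $\pi:T\to\mathbb{R}$ such that $\pi(e_\infty)=(\pi(v_\infty),\infty)$ and, for every injective path $\gamma:[0,1]\to T$ starting at a vertex and ending at $v_\infty$, $\pi\circ\gamma$ is monotonically increasing. A child of a vertex $v$ is a vertex $w$ joined to $v$ by an edge with $\pi(w)<\pi(v)$. Merge trees are isomorphic if there is a homeomorphism between them commuting with the maps to $\mathbb{R}$ (vertices that merely subdivide an edge may be removed). **Chiral merge trees.** A chiral merge tree is a merge tree in which every non-leaf vertex has two children, together with, for each such vertex, a labelling of the two edges to its children, one by $L$ (left) and the other by $R$ (right). Isomorphisms are isomorphisms of merge trees preserving the labels. **Morse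 sets.** A Morse set is a functor $S:(\mathbb{R},\le)\to$ finite sets, with shift maps $\varphi_{tr}:S(r)\to S(t)$ for $r\le t$, together with a finite minimal set of times $\tau_1<\dots<\tau_n$ such that: (1) $S(t)=\varnothing$ for $t<\tau_1$; (2) $S|_{[\tau_i,\tau_{i+1})}$ is naturally isomorphic to the constant functor with value $S(\tau_i)$ for $1\le i\le n-1$; (3) $S(t)$ is a one-point set for $t\ge\tau_n$; (4) for every $x\in S(\tau_{i+1})$, the fiber $\varphi_{\tau_{i+1}\tau_i}^{-1}(x)$ has cardinality $0$, $1$ or $2$; (5) each $y\in S(t)$ is contained in a unique oldest maximal chain of the poset $P_S$. Here $P_S=\bigcup_t S(t)\times\{t\}$ with $(x,r)\preceq(y,t)$ iff $r\le t$ and $\varphi_{tr}(x)=y$, and $\pi:P_S\to\mathbb{R}$ is the projection; a chain $C_1$ is older than a chain $C_2$ if some $t_1\in\pi(C_1)$ satisfies $t_1<t_2$ for all $t_2\in\pi(C_2)$. **Elder Rule.** Let $P_1=P_S$ and let $C_1$ be the oldest maximal chain containing the element of $P_1$ over $\tau_n$. Inductively set $P_{i+1}=P_i\setminus C_i$; if it is nonempty, let $\tau_k$ be the largest of the times $\tau_1,\dots,\tau_n$ over which $P_{i+1}$ has an element, take an element of $P_{i+1}$ over $\tau_k$, and let $C_{i+1}$ be the oldest maximal chain of $P_{i+1}$ containing it. The resulting multiset of intervals $E(S)=\{\pi(C_i)\}$ is the barcode associated to $S$ by the Elder Rule. **Elder maps.** The merge tree associated to a Morse set $S$ is $\left(\bigsqcup_{i=1}^{n-1}S(\tau_i)\times[\tau_i,\tau_{i+1}]\sqcup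 S(\tau_n)\times[\tau_n,\infty)\right)/\!\sim$, where $(x,\tau_{i+1})$ with $x\in S(\tau_i)$ is identified with $(\varphi_{\tau_{i+1}\tau_i}(x),\tau_{i+1})$, projected to the second factor. A Morse tree is a merge tree associated to a Morse set; $\mathcal T$ is the set of isomorphism classes of Morse trees. The Elder map $\Xi:\mathcal T\to\mathcal B$ sends $\pi:T\to\mathbb{R}$ to $E(S)$, where $S(t)=\pi_0(\pi^{-1}(-\infty,t])$. The Chiral Elder map $\Xi_{\mathcal X}$ is the composition $\mathcal X\to\mathcal T\to\mathcal B$ that forgets the labels and then applies $\Xi$ (it is applied to chiral merge trees whose underlying merge tree is a Morse tree). **The map $\Psi$.** For a Morse-like $f$, the merge tree of $f$ is the merge tree associated to the Morse set $t\mapsto\pi_0(f^{-1}(-\infty,t])$. After removing subdividing vertices, each non-leaf vertex is a place where two components (intervals in $[0,1]$) merge; the edge corresponding to the left interval is labelled $L$ and the other $R$. This is the chiral merge tree of $f$, and $\Psi$ sends the class of $f$ to the class of its chiral merge tree.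
   Formalization: The formal statement assumes N ≥ 2 and that no left endpoint b_j equals any right endpoint d_k; in the excluded cases the fiber is empty (critical values must be distinct, and minima at 0 and 1 give at least two bars) while the formula is positive. *)

(* Defs.v *)
From HB Require Import structures.
From Stdlib Require Import Relation_Operators.
From mathcomp Require Import all_boot all_order all_algebra generic_quotient.
From mathcomp Require Import all_classical all_reals all_analysis.

Set Implicit Arguments.
Unset Strict Implicit.
Unset Printing Implicit Defensive.

Import Order.TTheory GRing.Theory Num.Theory.
Import numFieldNormedType.Exports.

Local Open Scope classical_set_scope.
Local Open Scope ring_scope.
Local Open Scope card_scope.

(* The subtype of the reals in [0,1], with the subspace topology. *)
Notation I01 R := (set_type (`[0%R, 1%R]%classic : set R)).

Section UnitInterval.
Variable R : realType.

Lemma mem_I01_0 : (0 : R) \in (`[0, 1]%classic : set R).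
Proof. by rewrite inE /= in_itv /= lexx ler01. Qed.

Lemma mem_I01_1 : (1 : R) \in (`[0, 1]%classic : set R).
Proof. by rewrite inE /= in_itv /= lexx ler01. Qed.

Definition I0 : I01 R := SigSub mem_I01_0.
Definition I1 : I01 R := SigSub mem_I01_1.

Implicit Types f g : I01 R -> R.

Definition increasing_homeo (phi : I01 R -> I01 R) : Prop :=
  exists psi : I01 R -> I01 R,
    [/\ continuous phi, continuous psi, cancel phi psi, cancel psi phi &
        forall x y, set_val x < set_val y -> set_val (phi x) < set_val (phi y)].

Definition graph_equiv f g : Prop :=
  exists2 phi, increasing_homeo phi & f = g \o phi.

Definition graph_class f : set (I01 R -> R) := [set g | graph_equiv f g].

Definition local_min f (p : I01 R) : Prop := \forall x \near p, f p <= f x.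
Definition local_max f (p : I01 R) : Prop := \forall x \near p, f x <= f p.
Definition critical f (p : I01 R) : Prop := local_min f p \/ local_max f p.

Definition piecewise_linear f : Prop :=
  exists (n : nat) (k : nat -> R),
    [/\ k 0%N = 0, k n = 1,
        forall i, (i < n)%N -> k i < k i.+1 &
        forall i, (i < n)%N -> exists a c : R, forall x : I01 R,
          k i <= set_val x <= k i.+1 -> f x = a * set_val x + c].

Definition morse_like f : Prop :=
  continuous f /\
  exists g, [/\ piecewise_linear g,
    forall p, critical g p -> \forall x \near p, critical g x -> x = p,
    forall p q, critical g p -> critical g q -> g p = g q -> p = q &
    graph_equiv f g].

Definition in_M f : Prop :=
  [/\ morse_like f, local_min f I0 & local_min f I1].

End UnitInterval.

Record barcode (R : realType) := Barcode {
  mult :> set R -> nat;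
  mult_interval : forall J, mult J <> 0%N -> is_interval J
}.

(* Cardinality, with multiplicity, of the sub-multiset of the bars of B that
   strictly contain J. The big operator is 0 when infinitely many K contribute,
   so this is meaningful for finite B. *)
Definition mu (R : realType) (B : barcode R) (J : set R) : nat :=
  \big[addn/0%N]_(K \in [set K : set R | J `<` K]) B K.

(* The data of a functor from (R, <=) to sets, all of whose values are subsets
   of one type U. [shift r t] is relevant only for r <= t, on [stage r]. *)
Record pset (R : realType) (U : choiceType) := PSet {
  stage : R -> set U;
  shift : R -> R -> U -> U
}.

Section MorseSets.
Variables (R : realType) (U : choiceType).
Implicit Types (S : pset R U) (tau : seq R) (C P : set (U * R)).

Definition functorial S : Prop :=
  [/\ forall r t x, r <= t -> stage S r x -> stage S t (shift S r t x),
      forall t x, stage S t x -> shift S t t x = x &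
      forall r s t x, r <= s -> s <= t -> stage S r x ->
        shift S s t (shift S r s x) = shift S r t x].

Definition poset_of S : set (U * R) := [set p | stage S p.2 p.1].

Definition prec S (p q : U * R) : Prop :=
  p.2 <= q.2 /\ shift S p.2 q.2 p.1 = q.1.

Definition chain S P C : Prop :=
  C `<=` P /\ forall p q, C p -> C q -> prec S p q \/ prec S q p.

Definition maximal_chain S P C : Prop :=
  chain S P C /\ forall C', chain S P C' -> C `<=` C' -> C' = C.

Definition proj_chain C : set R := snd @` C.

Definition older C1 C2 : Prop :=
  exists2 t1, proj_chain C1 t1 & forall t2, proj_chain C2 t2 -> t1 < t2.

(* Strictly older than every other maximal chain of P containing p, hence
   unique. *)
Definition oldest_chain S P (p : U * R) C : Prop :=
  [/\ maximal_chain S P C, C p &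
      forall C', maximal_chain S P C' -> C' p -> C' <> C -> older C C'].

(* tau = [:: tau_1; ...; tau_n] is read with indices starting at 0. *)
Definition morse_times S tau : Prop :=
  let T i := nth 0 tau i in
  let n := size tau in
  (0 < n)%N /\ sorted (fun x y : R => x < y) tau /\
  (forall t, t < T 0%N -> stage S t = set0) /\
  (* eta is a natural isomorphism from the constant functor *)
  (forall i, (i.+1 < n)%N -> exists eta : R -> U -> U,
     (forall t, T i <= t < T i.+1 ->
        set_bij (stage S (T i)) (stage S t) (eta t)) /\
     (forall r t x, T i <= r -> r <= t -> t < T i.+1 -> stage S (T i) x ->
        shift S r t (eta r x) = eta t x)) /\
  (forall t, T n.-1 <= t -> exists x, stage S t = [set x]) /\
  (forall i x, (i.+1 < n)%N -> stage S (T i.+1) x ->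
     exists2 k, (k <= 2)%N &
       [set y | stage S (T i) y /\ shift S (T i) (T i.+1) y = x] #= `I_k) /\
  (forall t y, stage S t y ->
     exists! C, oldest_chain S (poset_of S) (y, t) C).

Definition morse_axioms S tau : Prop :=
  [/\ functorial S, forall t, finite_set (stage S t), morse_times S tau &
      forall tau', morse_times S tau' -> {subset tau' <= tau} -> tau' = tau].

Record morse_set := MorseSet {
  ms_pset :> pset R U;
  ms_times : seq R;
  ms_axioms : morse_axioms ms_pset ms_times
}.

(* [elder_run S tau P Cs]: started from the subposet P, the inductive
   procedure of the Elder Rule can produce the successive chains Cs. *)
Inductive elder_run S tau : set (U * R) -> seq (set (U * R)) -> Prop :=
| elder_stop : elder_run S tau set0 [::]
| elder_step P p C Cs :
    P p -> p.2 \in tau -> (forall q, P q -> q.2 \in tau -> q.2 <= p.2) ->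
    oldest_chain S P p C -> elder_run S tau (P `\` C) Cs ->
    elder_run S tau P (C :: Cs).

(* B = E(S) *)
Definition elder_rule (S : morse_set) (B : barcode R) : Prop :=
  exists2 Cs, elder_run S (ms_times S) (poset_of S) Cs &
    forall J, B J = count_mem J [seq proj_chain C | C <- Cs].

End MorseSets.

Section Pi0.
Variables (R : realType) (X : topologicalType).

Definition path_in (A : set X) (x y : X) : Prop :=
  exists gamma : I01 R -> X,
    [/\ continuous gamma, gamma (I0 R) = x, gamma (I1 R) = y &
        range gamma `<=` A].

Definition path_component (A : set X) (x : X) : set X :=
  [set y | path_in A x y].

Definition sublevel (h : X -> R) (t : R) : set X := [set x | h x <= t].

(* t |-> pi_0 (h^-1 (-oo, t]), with the maps induced by inclusion *)
Definition pi0_sublevel (h : X -> R) : pset R (set X) := PSet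
  (fun t => path_component (sublevel h t) @` sublevel h t)
  (fun _ t C => \bigcup_(x in C) path_component (sublevel h t) x).

End Pi0.

Record space_over (R : realType) := SpaceOver {
  so_space :> topologicalType;
  so_map : so_space -> R
}.

Definition iso_over (R : realType) (T T' : space_over R) : Prop :=
  exists (phi : T -> T') (psi : T' -> T),
    [/\ continuous phi, continuous psi, cancel phi psi, cancel psi phi &
        forall x, so_map (phi x) = so_map x].

Section MergeTreeOfMorseSet.
Local Open Scope quotient_scope.
Variables (R : realType) (U : choiceType) (S : morse_set R U).

Let T i : R := nth 0 (ms_times S) i.
Let n := size (ms_times S).

(* pairs (i, x) with x in S(tau_i) *)
Definition cell : choiceType :=
  set_type [set c : nat * U | (c.1 < n)%N /\ stage S (T c.1) c.2].

Definition cell_itv (i : nat) : set R :=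
  if (i.+1 < n)%N then `[T i, T i.+1]%classic else `[T i, +oo[%classic.

Definition cell_space (c : cell) : topologicalType :=
  set_type (cell_itv (set_val c).1).

Definition cells : topologicalType := {c : cell & cell_space c}.

Definition cell_index (a : cells) : nat := (set_val (projT1 a)).1.
Definition cell_elt (a : cells) : U := (set_val (projT1 a)).2.
Definition cell_height (a : cells) : R := set_val (projT2 a : set_type _).

Definition glue1 (a b : cells) : Prop :=
  [/\ cell_index b = (cell_index a).+1,
      cell_elt b =
        shift S (T (cell_index a)) (T (cell_index a).+1) (cell_elt a),
      cell_height a = T (cell_index a).+1 &
      cell_height b = T (cell_index a).+1].

Let glueb (a b : cells) : bool := `[< clos_refl_sym_trans _ glue1 a b >].

Lemma glueb_refl : reflexive glueb.
Proof. by move=> a; apply/asboolP; exact: rst_refl. Qed.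

Lemma glueb_sym : symmetric glueb.
Proof.
by move=> a b; apply/idP/idP => /asboolP ab; apply/asboolP; exact: rst_sym.
Qed.

Lemma glueb_trans : transitive glueb.
Proof.
by move=> b a c /asboolP ab /asboolP bc; apply/asboolP; exact: rst_trans bc.
Qed.

Definition glue : equiv_rel cells :=
  EquivRel glueb glueb_refl glueb_sym glueb_trans.

Definition tree_space : topologicalType := quotient_topology {eq_quot glue}.

(* Glued points have the same height, so the choice of representative is
   immaterial. *)
Definition tree_height (p : tree_space) : R :=
  cell_height (repr (p : {eq_quot glue})).

Definition merge_tree : space_over R := SpaceOver tree_height.

End MergeTreeOfMorseSet.

Definition is_morse_tree (R : realType) (T : space_over R) : Prop :=
  exists (U : choiceType) (S : morse_set R U), iso_over T (merge_tree S).

(* The Elder map as a relation, Xi(T) = B. *)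
Definition Elder (R : realType) (T : space_over R) (B : barcode R) : Prop :=
  is_morse_tree T /\
  exists2 S : morse_set R (set T),
    ms_pset S = pi0_sublevel (@so_map R T) & elder_rule S B.

(* A chiral merge tree whose underlying merge tree is the Morse tree of
   [ch_morse]. In that tree, the cell (i, y) is the edge going up from y in
   S(tau_i) to the vertex [shift y] in S(tau_(i+1)). As the fibers of
   these shifts have at most two elements, once the subdividing vertices are
   removed the non-leaf vertices are those with two such cells directly below
   them, and each edge to a child of such a
   vertex ends with one of these cells. [ch_left] labels that edge through that
   cell, [true] for L and [false] for R; its value on the other cells carries
   no information. *)
Record chiral_tree (R : realType) (U : choiceType) := ChiralTree {
  ch_morse : morse_set R U;
  ch_left : nat -> U -> bool;
  ch_axiom : forall i y z, let T := nth 0 (ms_times ch_morse) in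
    (i.+1 < size (ms_times ch_morse))%N ->
    stage ch_morse (T i) y -> stage ch_morse (T i) z -> y <> z ->
    shift ch_morse (T i) (T i.+1) y = shift ch_morse (T i) (T i.+1) z ->
    ch_left i y != ch_left i z
}.

Definition forget_labels (R : realType) (U : choiceType)
  (X : chiral_tree R U) : space_over R := merge_tree (ch_morse X).

Definition ChiralElder (R : realType) (U : choiceType)
    (X : chiral_tree R U) (B : barcode R) : Prop :=
  Elder (forget_labels X) B.

Section PH0.
Variable R : realType.
Implicit Types (f : I01 R -> R) (B : barcode R).

Definition left_of (C D : set (I01 R)) : Prop :=
  forall x y, C x -> D y -> set_val x < set_val y.

Definition Psi f (X : chiral_tree R (set (I01 R))) : Prop :=
  let S := ch_morse X in
  let T := nth 0 (ms_times S) in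
  ms_pset S = pi0_sublevel f /\
  forall i C D, (i.+1 < size (ms_times S))%N ->
    stage S (T i) C -> stage S (T i) D -> left_of C D ->
    shift S (T i) (T i.+1) C = shift S (T i) (T i.+1) D ->
    ch_left X i C /\ ~~ ch_left X i D.

Definition PH0 f B : Prop :=
  exists2 X, Psi f X & ChiralElder X B.

Definition PH0_fiber B : set (set (I01 R -> R)) :=
  [set c | exists f, [/\ in_M f, PH0 f B & c = graph_class f]].

End PH0.

(* Main.v *)
Require Import Defs.
From Stdlib Require Import Relation_Operators.
From mathcomp Require Import all_boot all_order all_algebra generic_quotient.
From mathcomp Require Import all_classical all_reals all_analysis.
From mathcomp Require Import zify lra.

(* The proof encodes a function by the word of its critical values, alternating
   between minima and maxima; two functions are graph-equivalent iff they have
   the same word, and every alternating word with distinct letters occurs.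
   Number the bars by decreasing death. Deleting the lowest maximum of a word
   together with its higher neighbouring minimum removes exactly the last
   bar I_n, and its lower neighbour is the birth of a bar strictly containing
   I_n. So a word with barcode I_1, ..., I_n arises from a word with barcode
   I_1, ..., I_(n-1) by choosing a bar strictly containing I_n and a side,
   that is, in 2 mu(I_n) ways.

   The functor pi_0 of the sublevel sets, of a function or of its merge tree,
   has as components at time t the classes of births up to t, two of them being
   identified when they have the same eldest representative [rep t]. This
   presentation determines the critical times and all oldest chains, hence the
   run of the Elder Rule. *)

Set Implicit Arguments.
Unset Strict Implicit.
Unset Printing Implicit Defensive.

Import Order.TTheory GRing.Theory Num.Theory.
Import numFieldNormedType.Exports.
Local Open Scope classical_set_scope.
Local Open Scope ring_scope.
Local Open Scope card_scope.

(** * Words of critical values *)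

(* [lia] without the order hypotheses on the coefficients, whose boolean
   structure it would otherwise explore. *)
Ltac natlia := repeat match goal with
  | H : is_true (uniq _) |- _ => clear H
  | H : is_true (perm_eq _ _) |- _ => clear H
  | H : is_true (_ \in _) |- _ => clear H
  | H : is_true (~~ (_ \in _)) |- _ => clear H
  | H : is_true (@Order.lt _ _ _ _) |- _ => clear H
  | H : is_true (@Order.le _ _ _ _) |- _ => clear H
  | H : _ = @Order.lt _ _ _ _ |- _ => clear H
  end; lia.

(** Below the lowest maximum every minimum is alone in its component. So the merge at that maximum
    joins just its two neighbouring minima, the bar of the higher one ends there, and all later
    merges see only the lower one: this is why a pair can be removed or attached without disturbing
    the other bars. The count itself is then combinatorial. The obstacle is that [Elder] does not
    read the given Morse set: it recomputes path components in the quotient space glued from it, and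
    its stages are sets of points of that space. Instead of transporting Morse sets along
    isomorphisms, the record [presented] keeps only what the Elder Rule depends on, phrased through
    [rep] for an arbitrary type of components. It is established for the sublevel sets of a
    function, then carried over to those of the merge tree with the same [rep]. Local minima at both
    end points make a word begin and end with a minimum, whence n + 1 minima for n maxima. Each
    finite bar contributes the factor 2 for the two sides of its host. *)

Section Insertion.
Variables (T : eqType) (x0 : T).
Implicit Types (l : seq T) (i p : nat).

Definition insert_at p x l := take p l ++ x :: drop p l.

Lemma nth_insert_at p x l i : (p <= size l)%N ->
  nth x0 (insert_at p x l) i =
  if (i < p)%N then nth x0 l i else if i == p then x else nth x0 l i.-1.
Proof.
move=> hp; rewrite nth_cat size_takel //.
case: ltnP => hi; first by rewrite nth_take.
case: eqP => [->|ne]; first by rewrite subnn.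
have -> : (i - p)%N = (i.-1 - p).+1 by lia.
by rewrite /= nth_drop; congr nth; lia.
Qed.

Lemma perm_insert_at p x l : perm_eq (insert_at p x l) (x :: l).
Proof. by rewrite /insert_at -cat1s perm_catCA cat1s cat_take_drop. Qed.

(** A left inverse of insertion, available as soon as the inserted value is new. *)
Lemma filter_insert_at p x l : x \notin l ->
  [seq y <- insert_at p x l | y != x] = l.
Proof.
move=> xl; rewrite filter_cat /= eqxx /= -filter_cat cat_take_drop.
by apply/all_filterP/allP => y yl; apply: contraNneq xl => <-.
Qed.

Lemma index_insert_at p x l : x \notin l -> (p <= size l)%N ->
  index x (insert_at p x l) = p.
Proof.
move=> xl hp; rewrite index_cat /= eqxx addn0 size_takel //.
by rewrite (contraNF (@mem_take _ _ _ _)).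
Qed.

Definition delete_at p l := take p l ++ drop p.+1 l.

Lemma size_delete_at p l : (p < size l)%N -> size (delete_at p l) = (size l).-1.
Proof. by move=> h; rewrite size_cat size_takel 1?ltnW // size_drop; lia. Qed.

Lemma nth_delete_at p l i : (p < size l)%N ->
  nth x0 (delete_at p l) i = if (i < p)%N then nth x0 l i else nth x0 l i.+1.
Proof.
move=> h; rewrite nth_cat (size_takel (ltnW h)).
have [hi|hi] := ltnP i p; first by rewrite nth_take.
by rewrite nth_drop; congr nth; lia.
Qed.

Lemma delete_atK p l : (p < size l)%N ->
  insert_at p (nth x0 l p) (delete_at p l) = l.
Proof.
move=> h; rewrite /insert_at /delete_at take_size_cat ?size_takel 1?ltnW //.
by rewrite drop_size_cat ?size_takel 1?ltnW // -drop_nth // cat_take_drop.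
Qed.

End Insertion.

Section Words.
Variable R : realDomainType.
Implicit Types (b d : nat -> R) (n : nat) (w : seq R * seq R).

(** Index 0 is the infinite bar: the bars numbered 1, ..., N in the theorem become 0, ..., n with n
    = N - 1, and deaths start at index 1. *)
Record bars_ok b d n := BarsOk {
  births_inj : forall i j, (i <= n)%N -> (j <= n)%N -> b i = b j -> i = j;
  birth_lt_death : forall i, (0 < i <= n)%N -> b i < d i;
  deaths_decr : forall i j, (0 < i)%N -> (i < j <= n)%N -> d j < d i;
  birth_neq_death : forall i j, (i <= n)%N -> (0 < j <= n)%N -> b i <> d j
}.

(* A word is the pair of the sequences of its minima and of its maxima. The new
   minimum v is put next to the minimum c, with the maximum e in between, on the
   right of c if s holds and on its left otherwise. *)
Definition attach (v e c : R) w (s : bool) :=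
  (insert_at (index c w.1 + s) v w.1, insert_at (index c w.1) e w.2).

(** Hosts and sides for bar n. A merge ends the bar with the higher birth, so bar n ends at the new
    maximum only if its minimum is placed next to a lower one. *)
Definition sites b n : seq (nat * bool) :=
  [seq (k, s) | k <- [seq k <- iota 0 n | b k < b n], s <- [:: true; false]].

Lemma mem_sites b n q : (q \in sites b n) = (q.1 < n)%N && (b q.1 < b n).
Proof.
case: q => k s /=; apply/allpairsP/andP => [[[k' s'] /= [+ _ [-> _]]]|[hk hb]].
  by rewrite mem_filter mem_iota => /andP[].
by exists (k, s); split => //=; [rewrite mem_filter mem_iota hb|case: s].
Qed.

Lemma sites_uniq b n : uniq (sites b n).
Proof.
by apply: allpairs_uniq => //; [rewrite filter_uniq // iota_uniq|move=> [? ?] [? ?]].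
Qed.

Lemma size_sites b n : size (sites b n) = (count (fun k => b k < b n)%R (iota 0 n) * 2)%N.
Proof. by rewrite size_allpairs size_filter. Qed.

Fixpoint words b d n : seq (seq R * seq R) :=
  if n is m.+1 then
    [seq attach (b n) (d n) (b q.1) w q.2 | w <- words b d m, q <- sites b n]
  else [:: ([:: b 0%N], [::])].

(** Sequences describing the same bars may still differ beyond index n and at [d 0]. *)
Lemma words_ext b d b' d' n :
  (forall i, (i <= n)%N -> b i = b' i) ->
  (forall i, (0 < i <= n)%N -> d i = d' i) -> words b d n = words b' d' n.
Proof.
elim: n => [|n IH] hb hd /=; first by rewrite hb.
rewrite IH; [|by move=> i hi; apply: hb; lia|by move=> i hi; apply: hd; lia].
rewrite hb // hd //; last by lia.
have -> : sites b n.+1 = sites b' n.+1.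
  rewrite /sites hb //; congr (flatten (map _ _)); apply: eq_in_filter => k.
  by rewrite mem_iota add0n => /andP[_ hk]; rewrite hb // ltnW.
congr flatten; apply: eq_map => w; apply/eq_in_map => q.
by rewrite mem_sites => /andP[hk _]; rewrite hb // ltnW.
Qed.

Lemma mem_wordsS b d n w :
  reflect (exists w0 k s, [/\ w0 \in words b d n, (k <= n)%N, b k < b n.+1 &
             w = attach (b n.+1) (d n.+1) (b k) w0 s])
          (w \in words b d n.+1).
Proof.
apply: (iffP allpairsP) => [[[w0 [k s]] /= [hw0]]|].
  by rewrite mem_sites /= => /andP[hk hb] ->; exists w0, k, s.
move=> [w0 [k [s [hw0 hk hb ->]]]]; exists (w0, (k, s)); split => //=.
by rewrite mem_sites hb andbT.
Qed.

Lemma bars_okW b d n : bars_ok b d n.+1 -> bars_ok b d n.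
Proof.
case=> h1 h2 h3 h4; split.
- by move=> i j hi hj; apply: h1; lia.
- by move=> i hi; apply: h2; lia.
- by move=> i j hi hj; apply: h3; lia.
- by move=> i j hi hj; apply: h4; lia.
Qed.

Lemma perm_words1 b d n w :
  w \in words b d n -> perm_eq w.1 [seq b k | k <- iota 0 n.+1].
Proof.
elim: n w => [|n IH] w; first by rewrite inE => /eqP ->.
case/mem_wordsS => w0 [k [s [/IH hw0 _ _ ->]]].
apply: (perm_trans (perm_insert_at _ _ _)).
have -> : iota 0 n.+2 = rcons (iota 0 n.+1) n.+1.
  by rewrite -cats1 -(iotaD 0 n.+1 1) addn1.
by rewrite map_rcons perm_sym perm_rcons perm_sym perm_cons.
Qed.

Lemma perm_words2 b d n w :
  w \in words b d n -> perm_eq w.2 [seq d k | k <- iota 1 n].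
Proof.
elim: n w => [|n IH] w; first by rewrite inE => /eqP ->.
case/mem_wordsS => w0 [k [s [/IH hw0 _ _ ->]]].
apply: (perm_trans (perm_insert_at _ _ _)).
have -> : iota 1 n.+1 = rcons (iota 1 n) n.+1.
  by rewrite -cats1 -add1n -(iotaD 1 n 1) addn1.
by rewrite map_rcons perm_sym perm_rcons perm_sym perm_cons.
Qed.

Lemma size_words1 b d n w : w \in words b d n -> size w.1 = n.+1.
Proof. by move=> /perm_words1/perm_size; rewrite size_map size_iota. Qed.

Lemma size_words2 b d n w : w \in words b d n -> size w.2 = n.
Proof. by move=> /perm_words2/perm_size; rewrite size_map size_iota. Qed.

Lemma birth_mem_words b d n w k :
  w \in words b d n -> (k <= n)%N -> b k \in w.1.
Proof. by move=> /perm_words1/perm_mem -> hk; apply: map_f; rewrite mem_iota. Qed.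

Lemma index_birth_words b d n w k :
  w \in words b d n -> (k <= n)%N -> (index (b k) w.1 <= n)%N.
Proof. by move=> hw hk; rewrite -ltnS -(size_words1 hw) index_mem (birth_mem_words hw). Qed.

Lemma nth_words1 b d n w i : w \in words b d n -> (i <= n)%N ->
  exists2 k, (k <= n)%N & nth 0 w.1 i = b k.
Proof.
move=> hw hi; have : nth 0 w.1 i \in w.1 by rewrite mem_nth // (size_words1 hw).
rewrite (perm_mem (perm_words1 hw)) => /mapP[k].
by rewrite mem_iota => /andP[_ hk] ->; exists k.
Qed.

Lemma nth_words2 b d n w i : w \in words b d n -> (i < n)%N ->
  exists2 k, (0 < k <= n)%N & nth 0 w.2 i = d k.
Proof.
move=> hw hi; have : nth 0 w.2 i \in w.2 by rewrite mem_nth // (size_words2 hw).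
rewrite (perm_mem (perm_words2 hw)) => /mapP[k].
by rewrite mem_iota => hk ->; exists k.
Qed.

Lemma uniq_births b d n m : bars_ok b d n -> (m <= n.+1)%N ->
  uniq [seq b k | k <- iota 0 m].
Proof.
move=> ok hm; rewrite map_inj_in_uniq ?iota_uniq // => i j.
rewrite !mem_iota => hi hj; apply: (births_inj ok); lia.
Qed.

Lemma uniq_deaths b d n : bars_ok b d n -> uniq [seq d k | k <- iota 1 n].
Proof.
move=> ok; rewrite map_inj_in_uniq ?iota_uniq // => i j.
rewrite !mem_iota => hi hj e.
have [ij|ji|//] := ltngtP i j.
- by have := deaths_decr ok (i:=i) (j:=j); rewrite e ltxx; lia.
- by have := deaths_decr ok (i:=j) (j:=i); rewrite e ltxx; lia.
Qed.

Lemma uniq_words b d n w : bars_ok b d n -> w \in words b d n -> uniq (w.1 ++ w.2).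
Proof.
move=> ok hw; rewrite cat_uniq (perm_uniq (perm_words1 hw)) (uniq_births ok) //.
rewrite (perm_uniq (perm_words2 hw)) (uniq_deaths ok) andbT /=.
apply/hasPn => x; rewrite (perm_mem (perm_words2 hw)) => /mapP[j].
rewrite mem_iota => hj ->; rewrite (perm_mem (perm_words1 hw)).
apply/mapP => -[i]; rewrite mem_iota => hi /esym.
by apply: (birth_neq_death ok); lia.
Qed.

Lemma birth_notin_words b d n w : bars_ok b d n.+1 -> w \in words b d n ->
  b n.+1 \notin w.1.
Proof.
move=> ok hw; rewrite (perm_mem (perm_words1 hw)).
apply/mapP => -[i]; rewrite mem_iota => hi e.
by have := births_inj ok (leqnn _) _ e; lia.
Qed.

Lemma death_notin_words b d n w : bars_ok b d n.+1 -> w \in words b d n ->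
  d n.+1 \notin w.2.
Proof.
move=> ok hw; rewrite (perm_mem (perm_words2 hw)).
apply/mapP => -[i]; rewrite mem_iota => hi e.
by have := deaths_decr ok (i:=i) (j:=n.+1); rewrite e ltxx; lia.
Qed.

(** Both inserted values are new to the word, so erasing them gives back [w]. The position of the
    new maximum is the position of the host, and the offset of the new minimum from it is the
    side. *)
Lemma attach_inj b d n w w' (k k' : nat) (s s' : bool) : bars_ok b d n.+1 ->
  w \in words b d n -> w' \in words b d n -> (k <= n)%N -> (k' <= n)%N ->
  attach (b n.+1) (d n.+1) (b k) w s = attach (b n.+1) (d n.+1) (b k') w' s' ->
  (w, (k, s)) = (w', (k', s')).
Proof.
move=> ok hw hw' hk hk' [e1 e2].
have nb := birth_notin_words ok; have nd := death_notin_words ok.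
have ew : w = w'.
  rewrite [w]surjective_pairing [w']surjective_pairing; congr pair.
    by rewrite -(filter_insert_at (index (b k) w.1 + s) (nb _ hw)) e1 filter_insert_at ?nb.
  by rewrite -(filter_insert_at (index (b k) w.1) (nd _ hw)) e2 filter_insert_at ?nd.
move: hw' e1 e2; rewrite -{w'}ew => _ e1 e2.
have ik := index_birth_words hw hk; have ik' := index_birth_words hw hk'.
have e : index (b k) w.1 = index (b k') w.1.
  have := index_insert_at (p:=index (b k) w.1) (nd _ hw).
  by rewrite e2 index_insert_at ?nd ?(size_words2 hw) // => ->.
congr (_, (_, _)).
  apply: (births_inj ok); [lia|lia|].
  have mk := birth_mem_words hw hk; have mk' := birth_mem_words hw hk'.
  by rewrite -(nth_index 0 mk) e nth_index.
have := index_insert_at (p:=index (b k) w.1 + s) (nb _ hw).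
have le (c : bool) : (index (b k') w.1 + c <= size w.1)%N.
  by rewrite (size_words1 hw); case: c; lia.
rewrite e1 e index_insert_at ?nb ?le // => /(_ isT).
by case: (s); case: (s'); lia.
Qed.

Lemma words_uniq b d n : bars_ok b d n -> uniq (words b d n).
Proof.
elim: n => // n IH ok /=; apply: allpairs_uniq.
- exact/IH/bars_okW.
- exact: sites_uniq.
move=> u u' /allpairsP[[w [k s]] [/= hw + ->]] /allpairsP[[w' [k' s']] [/= hw' + ->]] {u u'}.
by rewrite !mem_sites /= => /andP[hk _] /andP[hk' _]; apply: attach_inj.
Qed.

(** The number of sites depends on the bars only, not on the word they belong to; this is what turns
    the count into a product. *)
Lemma size_words b d n : size (words b d n) =
  (2 ^ n * \prod_(1 <= j < n.+1) count (fun k => b k < b j)%R (iota 0 j))%N.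
Proof.
elim: n => [|n IH]; first by rewrite big_geq.
rewrite big_nat_recr // [words _ _ _]/= size_allpairs size_sites IH expnS.
by rewrite mulnA [(_ * 2)%N]mulnC !mulnA.
Qed.

Definition zigzag n w := forall l, (l < n)%N ->
  nth 0 w.1 l < nth 0 w.2 l /\ nth 0 w.1 l.+1 < nth 0 w.2 l.

(** The new maximum is above its neighbours because [b k < b n.+1 < d n.+1]; an old maximum that
    gets the new minimum as a neighbour is a higher death, so it is above it as well. *)
Lemma zigzag_words b d n w : bars_ok b d n -> w \in words b d n -> zigzag n w.
Proof.
elim: n w => [|n IH] w ok; first by [].
have ok' := bars_okW ok.
case/mem_wordsS => w0 [k [s [hw0 hk hb ->]]] l hl /=.
have z0 := IH _ ok' hw0.
have s1 := size_words1 hw0; have s2 := size_words2 hw0.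
have ip := index_birth_words hw0 hk.
have ep : nth 0 w0.1 (index (b k) w0.1) = b k.
  by rewrite nth_index // (birth_mem_words hw0).
set p := index _ _ in ip ep *.
have be : b n.+1 < d n.+1 by apply: (birth_lt_death ok); lia.
have low i : (i < n)%N -> b n.+1 < nth 0 w0.2 i.
  move=> hi; have [j hj ->] := nth_words2 hw0 hi.
  by apply: (lt_trans be); apply: (deaths_decr ok); lia.
have ps : (p + s <= size w0.1)%N by rewrite s1; case: (s); lia.
rewrite !nth_insert_at ?s2 //.
case: (ltngtP l p) => [lp|pl|->{l hl}].
- have [z1 z2] := z0 l ltac:(lia); split.
    by rewrite ifT //; lia.
  case: ifP => // h1; case: eqP => h2; last lia.
  by apply: low; lia.
- have [z1 z2] := z0 l.-1 ltac:(lia); move: z2.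
  rewrite (_ : l.-1.+1 = l); last lia; move=> z2.
  split.
    rewrite ifF; last by case: (s); lia.
    by case: eqP => // _; apply: low; lia.
  rewrite ifF; last by case: (s); lia.
  by rewrite ifF //; case: (s); lia.
- case: s ps => ps; rewrite ?addn1 ?addn0 ?ltnSn ?ltnn ?eqxx /=.
    by rewrite ep; split => //; apply: lt_trans be.
  rewrite ifF; last lia. rewrite ifF /=; last lia.
  by rewrite ep; split => //; apply: lt_trans be.
Qed.

(** [rep t k] is the index of the eldest bar in the component of the k-th birth at time t,
    meaningful once [b k <= t]. By [elder_death] and [elder_id] a bar of positive index represents
    itself exactly until its death; bar 0 always does, by [elder_le]. *)
Record elder b d n (rep : R -> nat -> nat) := Elder {
  elder_le : forall t k, (k <= n)%N -> b k <= t -> (rep t k <= k)%N;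
  elder_birth : forall t k, (k <= n)%N -> b k <= t -> b (rep t k) <= b k;
  elder_death : forall t k, (k <= n)%N -> b k <= t -> (0 < rep t k)%N -> t < d (rep t k);
  elder_id : forall t k, (k <= n)%N -> b k <= t -> (0 < k)%N -> t < d k -> rep t k = k;
  elder_comp : forall r t k, (k <= n)%N -> b k <= r -> r <= t -> rep t (rep r k) = rep t k
}.

Definition connected_at (t : R) (Ms : seq R) i j :=
  forall l, (i <= l < j)%N || (j <= l < i)%N -> nth 0 Ms l <= t.

Lemma connected_at_sym t Ms i j : connected_at t Ms i j -> connected_at t Ms j i.
Proof. by move=> h l hl; apply: h; rewrite orbC. Qed.

Definition elder_conn b d n w rep := elder b d n rep /\
  forall t k l, (k <= n)%N -> (l <= n)%N -> b k <= t -> b l <= t ->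
    connected_at t w.2 (index (b k) w.1) (index (b l) w.1) <-> rep t k = rep t l.

Lemma elder_words b d n w : bars_ok b d n -> w \in words b d n ->
  exists rep, elder_conn b d n w rep.
Proof.
elim: n w => [|n IH] w ok.
  rewrite inE => /eqP ->; exists (fun _ _ => 0%N); split.
    by split => // t k; rewrite leqn0 => /eqP ->.
  move=> t k l; rewrite !leqn0 => /eqP -> /eqP -> _ _; split => // _ i /=.
  by rewrite eqxx; natlia.
have ok' := bars_okW ok.
case/mem_wordsS => w0 [c [s [hw0 hc hb ->]]].
have [rep [el conn]] := IH _ ok' hw0.
have s1 := size_words1 hw0; have s2 := size_words2 hw0.
have ip k := @index_birth_words _ _ _ _ k hw0.
have be : b n.+1 < d n.+1 by apply: (birth_lt_death ok); natlia.
have low i : (i < n)%N -> d n.+1 < nth 0 w0.2 i.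
  by move=> hi; have [j hj ->] := nth_words2 hw0 hi; apply: (deaths_decr ok); natlia.
(* The new bar represents itself while it lives and is then represented like its host c; the old
   bars keep their representatives. *)
pose rep' t k := if (k <= n)%N then rep t k else
  if t < d n.+1 then n.+1 else rep t c.
have cle t : b n.+1 <= t -> b c <= t by move=> h; apply: le_trans h; exact: ltW.
have repn t k : (k <= n)%N -> b k <= t -> (rep t k <= n)%N.
  by move=> hk ht; apply: (leq_trans _ hk); apply: (elder_le el).
have lastn k : (k <= n.+1)%N -> (k <= n)%N = false -> k = n.+1 by natlia.
exists rep'; split.
  split.
  - move=> t k hk ht; rewrite /rep'; case: ifP => h; first exact: (elder_le el).
    move: ht; rewrite (lastn _ hk h) => ht; case: ifP => // _.
    by apply: leqW; apply: repn => //; exact: cle.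
  - move=> t k hk ht; rewrite /rep'; case: ifP => h; first exact: (elder_birth el).
    move: ht; rewrite (lastn _ hk h) => ht; case: ifP => // _.
    by apply: le_trans (ltW hb); apply: (elder_birth el) => //; exact: cle.
  - move=> t k hk ht; rewrite /rep'; case: ifP => h; first exact: (elder_death el).
    move: ht; rewrite (lastn _ hk h) => ht; case: ifP => // _.
    by apply: (elder_death el) => //; exact: cle.
  - move=> t k hk ht k0 td; rewrite /rep'; case: ifP => h; first exact: (elder_id el).
    by move: td; rewrite (lastn _ hk h) => ->.
  - move=> r t k hk hr rt; have [h|/negbTE h] := boolP (k <= n)%N; rewrite /rep' h.
      by rewrite repn //; apply: (elder_comp el).
    move: hr; rewrite (lastn _ hk h) => hr; have [rd|rd] := ltP r (d n.+1).
      by rewrite ltnn.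
    rewrite repn ?cle // (elder_comp el) ?cle //.
    by rewrite ltNge (le_trans rd rt).
set p := index (b c) w0.1.
have hp : (p <= n)%N by exact: ip.
have nb := birth_notin_words ok hw0.
pose phi k := index (b k) (attach (b n.+1) (d n.+1) (b c) w0 s).1.
have phi_last : phi n.+1 = (p + s)%N.
  by rewrite /phi index_insert_at ?s1 //; case: (s); natlia.
have phiE k : (k <= n)%N -> let i := index (b k) w0.1 in
    phi k = if (i < p + s)%N then i else i.+1.
  move=> hk i; rewrite /phi /=.
  have bw := birth_mem_words hw0 hk.
  have nbk : b n.+1 == b k = false by apply: contraNF nb => /eqP ->.
  have ss : (p + s <= size w0.1)%N by rewrite s1; case: (s); natlia.
  rewrite index_cat /= nbk -[X in (i < X)%N](size_takel ss).
  rewrite -index_mem.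
  have u : uniq w0.1 by have := uniq_words ok' hw0; rewrite cat_uniq => /and3P[].
  have /= := index_cat (b k) (take (p + s) w0.1) (drop (p + s) w0.1).
  rewrite cat_take_drop -/i; case: ifP => h.
    by move=> ->; rewrite index_mem h.
  move=> ->; rewrite -index_mem in h.
  by rewrite -/p h ifF ?addnS //; natlia.
have nthM i : nth 0 (attach (b n.+1) (d n.+1) (b c) w0 s).2 i =
    if (i < p)%N then nth 0 w0.2 i else if i == p then d n.+1 else nth 0 w0.2 i.-1.
  by rewrite nth_insert_at // s2.
move: phi_last phiE nthM; rewrite /phi /=.
set M := insert_at _ _ w0.2; set m := insert_at _ _ w0.1 => phi_last phiE nthM.
have nthMlt i : (i < p)%N -> nth 0 M i = nth 0 w0.2 i by rewrite nthM => ->.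
have nthMgt i : (p <= i)%N -> nth 0 M i.+1 = nth 0 w0.2 i.
  by move=> h; rewrite nthM ifF ?ifF //; natlia.
(* Any passage between two old minima over the new maximum also crosses an old maximum next to the
   inserted pair, and that one is higher; so old connections do not change. *)
have old t k l : (k <= n)%N -> (l <= n)%N -> 
    connected_at t M (index (b k) m) (index (b l) m) <->
    connected_at t w0.2 (index (b k) w0.1) (index (b l) w0.1).
  move=> hk hl; rewrite !phiE //.
  have := ip k hk; have := ip l hl.
  set i := index (b k) w0.1; set j := index (b l) w0.1 => jn iN.
  split => h q hq.
    have := h (if (q < p)%N then q else q.+1).
    case: (ltnP q p) => qp.
      by rewrite nthMlt //; apply; move: hq; case: (s); case: ifP; case: ifP; natlia.
    by rewrite nthMgt //; apply; move: hq; case: (s); case: ifP; case: ifP; natlia.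
  rewrite nthM; case: ifP => qp.
    by apply: h; move: hq; case: (s); case: ifP; case: ifP; natlia.
  case: eqP => qp'.
    have [ip'|jp'] : (((p < i) || (p < j)) && ((i <= p) || (j <= p)) \/
             ((p <= i) && (j < p)) || ((p <= j) && (i < p)))%N.
      by move: hq; case: (s); case: ifP; case: ifP; natlia.
      have: nth 0 w0.2 p <= t by apply: h; natlia.
      by apply: le_trans; apply/ltW/low; natlia.
    have: nth 0 w0.2 p.-1 <= t by apply: h; natlia.
    by apply: le_trans; apply/ltW/low; natlia.
  by apply: h; move: hq; case: (s); case: ifP; case: ifP; natlia.
(* Towards the host, the new minimum is left over the new maximum. On the other side the first
   obstacle is an old maximum, above [d n.+1] anyway. Either way the connection amounts to
   [d n.+1 <= t] and one from the host. *)
have new t l : (l <= n)%N -> b n.+1 <= t -> b l <= t ->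
    connected_at t M (index (b n.+1) m) (index (b l) m) <->
    d n.+1 <= t /\ rep t c = rep t l.
  move=> hl hn ht; rewrite -conn ?cle // phi_last phiE //.
  have := ip l hl; rewrite -/p; set j := index (b l) w0.1 => jn.
  split => [h|[hd h] q hq].
    have hd : d n.+1 <= t.
      have [jp|pj] : ((j <= p) && s || (p <= j) && ~~ s \/
            (j < p) && ~~ s || (p < j) && s)%N by case: (s); natlia.
        have := h p; rewrite nthM ltnn eqxx; apply.
        by move: jp; case: (s); case: ifP; natlia.
      have [jp|jp] := ltnP j p.
        have: nth 0 M p.-1 <= t.
          by apply: h; move: pj; case: (s); case: ifP; natlia.
        rewrite nthMlt; last natlia.
        by apply: le_trans; apply/ltW/low; natlia.
      have: nth 0 M p.+1 <= t.
        by apply: h; move: pj; case: (s); case: ifP; natlia.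
      by rewrite nthMgt //; apply: le_trans; apply/ltW/low; move: pj; case: (s); natlia.
    split => // q hq.
    have := h (if (q < p)%N then q else q.+1).
    case: (ltnP q p) => qp.
      by rewrite nthMlt //; apply; move: hq; case: (s); case: ifP; natlia.
    by rewrite nthMgt //; apply; move: hq; case: (s); case: ifP; natlia.
  rewrite nthM; case: ifP => qp.
    by apply: h; move: hq; case: (s); case: ifP; natlia.
  case: eqP => qp' //.
  by apply: h; move: hq; case: (s); case: ifP; natlia.
have main t l : (l <= n)%N -> b n.+1 <= t -> b l <= t ->
    connected_at t M (index (b n.+1) m) (index (b l) m) <-> rep' t n.+1 = rep' t l.
  move=> hl hn ht; rewrite new // /rep' hl ltnn.
  have rn := repn _ _ hl ht.
  by case: ltP => h; split; [move=> []|natlia|move=> []|].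
move=> t k l hk hl ht ht'.
have [kn|kn] := leqP k n; have [ln|ln] := leqP l n.
- by rewrite old // conn // /rep' kn ln.
- have el' : l = n.+1 by natlia.
  subst l; split => [h|h].
    by apply/esym/main => //; exact: connected_at_sym.
  by apply: connected_at_sym; apply/main.
- have el' : k = n.+1 by natlia.
  by subst k; exact: main.
- have -> : k = l by natlia.
  by split => // _ q; natlia.
Qed.

(** Inverse of [attach]: e is the lowest maximum, v the higher of its two neighbouring minima, and
    the other neighbour is the birth of the host. *)
Lemma zigzag_is_word n w : size w.1 = n.+1 -> size w.2 = n -> uniq (w.1 ++ w.2) ->
  zigzag n w -> exists b d, bars_ok b d n /\ w \in words b d n.
Proof.
elim: n w => [|n IH] [ms Ms] /= sm sM u z.
  case: ms sm Ms sM u z => [//|m [|//]] _ [|//] _ _ _.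
  exists (fun _ => m), (fun _ => m); split; last by rewrite inE.
  by split => //; natlia.
have [q hq qmin] : exists2 q, (q < n.+1)%N & forall i, (i < n.+1)%N -> nth 0 Ms q <= nth 0 Ms i.
  have [/= q _ h] := @Order.TotalTheory.arg_minP _ _ _ ord0 xpredT (fun i : 'I_n.+1 => nth 0 Ms i) isT.
  by exists q => // i hi; exact: (h (Ordinal hi) isT).
set e := nth 0 Ms q in qmin.
have [zq1 zq2] : nth 0 ms q < e /\ nth 0 ms q.+1 < e by exact: (z _ hq).
(* The flag s holds when the lower neighbour is on the left, so that v stands to the right of its
   host; r is then the position of v. The sigma types keep both opaque during case analysis. *)
have [s es] : {s | s = (nth 0 ms q < nth 0 ms q.+1)} by eexists.
have [r er] : {r | r = (q + s)%N} by eexists.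
have hr : (r < size ms)%N by rewrite sm er; case: (s); natlia.
have hqM : (q < size Ms)%N by rewrite sM.
pose v := nth 0 ms r.
pose w0 := (delete_at r ms, delete_at q Ms).
have s1 : size w0.1 = n.+1 by rewrite size_delete_at // sm.
have s2 : size w0.2 = n by rewrite size_delete_at // sM.
have p1 : perm_eq ms (v :: w0.1).
  by rewrite -[X in perm_eq X](delete_atK 0 hr) perm_insert_at.
have p2 : perm_eq Ms (e :: w0.2).
  by rewrite -[X in perm_eq X](delete_atK 0 hqM) perm_insert_at.
have u' : uniq ((v :: w0.1) ++ (e :: w0.2)).
  by rewrite -(perm_uniq (perm_cat p1 p2)).
have /and4P[vn _ en u0] : [&& v \notin w0.1, v \notin e :: w0.2,
     e \notin w0.1 ++ w0.2 & uniq (w0.1 ++ w0.2)].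
  move: u'; rewrite /= mem_cat negb_or -andbA => /and3P[-> ->] /=.
  by rewrite (perm_uniq (_ : perm_eq _ (e :: w0.1 ++ w0.2))) //= -cat1s perm_catCA.
have umM : forall i j, (i < size ms)%N -> (j < size Ms)%N -> nth 0 ms i != nth 0 Ms j.
  move=> i j hi hj; apply/eqP => E; move: u; rewrite cat_uniq => /and3P[_ /hasPn /(_ (nth 0 Ms j))].
  by rewrite mem_nth // -E mem_nth // => /(_ isT).
have uM : uniq Ms by move: u; rewrite cat_uniq => /and3P[].
have um : uniq ms by move: u; rewrite cat_uniq => /and3P[].
have elt' i : (i < n.+1)%N -> i != q -> e < nth 0 Ms i.
  by move=> hi iq; rewrite lt_neqAle qmin // andbT nth_uniq ?sM // eq_sym.
have elt i : (i < n)%N -> e < nth 0 w0.2 i.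
  by move=> hi; rewrite /= nth_delete_at //; case: ifP => iq; apply: elt'; natlia.
(* At most one maximum changes a neighbour: v is replaced by the lower neighbour of e, which is
   below e and so below every remaining maximum. *)
have z0 : zigzag n w0.
  move=> l hl; rewrite /= !nth_delete_at //.
  have E := elt l hl; rewrite /= nth_delete_at // in E.
  case: (ltnP l q) E => lq E.
    have [z1 z2] := z l ltac:(natlia); rewrite ifT; last by rewrite er; natlia.
    split => //; case: ifP => // h.
    have -> : l.+2 = q.+1 by rewrite er in h; natlia.
    exact: lt_trans E.
  have [z1 z2] := z l.+1 ltac:(natlia); split; last by rewrite ifF // er; case: (s); natlia.
  case: ifP => // h.
  have lq' : l = q by rewrite er in h; move: h; case: (s); natlia.
  by move: E; rewrite lq'; apply: lt_trans.
have [b0 [d0 [ok0 hw0]]] := IH w0 s1 s2 u0 z0.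
(* The bars of the shorter word are extended by v and e at index n + 1, where the induction
   hypothesis leaves the sequences free. *)
pose b i := if i == n.+1 then v else b0 i.
pose d i := if i == n.+1 then e else d0 i.
have hw : w0 \in words b d n.
  rewrite (words_ext (b':=b0) (d':=d0)) // => i hi; rewrite /b /d ifF //; natlia.
have bw i : (i <= n)%N -> b i \in w0.1.
  by move=> hi; apply: (birth_mem_words hw).
have dw i : (0 < i <= n)%N -> d i \in w0.2.
  by move=> hi; rewrite (perm_mem (perm_words2 hw)); apply: map_f; rewrite mem_iota; natlia.
have edw i : (0 < i <= n)%N -> e < d i.
  by move=> /dw /(nthP 0)[j hj <-]; apply: elt; rewrite -s2.
have bS : b n.+1 = v by rewrite /b eqxx.
have dS : d n.+1 = e by rewrite /d eqxx.
have ve : v < e by rewrite /v er; case: (s); rewrite ?addn1 ?addn0.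
have bE i : (i <= n)%N -> b i = b0 i by move=> hi; rewrite /b ifF //; natlia.
have dE i : (i <= n)%N -> d i = d0 i by move=> hi; rewrite /d ifF //; natlia.
exists b, d; split.
  split.
  - move=> i j hi hj.
    have [hi'|hi'] := leqP i n; have [hj'|hj'] := leqP j n; last natlia.
    + by rewrite !bE //; apply: (births_inj ok0).
    + rewrite (_ : j = n.+1) ?bS; last natlia.
      by move=> E; move: vn; rewrite -E bw.
    + rewrite (_ : i = n.+1) ?bS; last natlia.
      by move=> E; move: vn; rewrite E bw.
  - move=> i hi; have [hi'|hi'] := leqP i n.
      by rewrite bE // dE //; apply: (birth_lt_death ok0); natlia.
    by rewrite (_ : i = n.+1) ?bS ?dS //; natlia.
  - move=> i j i0 hij; have [hj'|hj'] := leqP j n.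
      by rewrite !dE; [apply: (deaths_decr ok0)| |]; natlia.
    by rewrite (_ : j = n.+1) ?dS; [apply: edw|]; natlia.
  - move=> i j hi hj.
    have mi : b i \in v :: w0.1.
      have [hi'|hi'] := leqP i n; first by rewrite inE bw // orbT.
      by rewrite (_ : i = n.+1) ?bS ?mem_head //; natlia.
    have mj : d j \in e :: w0.2.
      have [hj'|hj'] := leqP j n; first by rewrite inE dw ?orbT //; natlia.
      by rewrite (_ : j = n.+1) ?dS ?mem_head //; natlia.
    move=> E; move: u'; rewrite cat_uniq => /and3P[_ /hasPn /(_ _ mj)].
    by rewrite -E mi.
apply/mem_wordsS.
have q0 : (q <= n)%N by natlia.
have cE : nth 0 w0.1 q = if s then nth 0 ms q else nth 0 ms q.+1.
  rewrite /= nth_delete_at // er; case: (s); first by rewrite ifT //; natlia.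
  by rewrite ifF //; natlia.
have [k hk kE] := nth_words1 hw q0.
exists w0, k, s; split => //.
  rewrite -kE cE bS /v er; case E: (s); rewrite ?addn1 ?addn0 //.
    by rewrite -es E.
  move/negbT: E; rewrite es -leNgt le_eqVlt nth_uniq ?sm //; last by natlia.
  by rewrite gtn_eqF.
have iq : index (b k) w0.1 = q.
  rewrite -kE index_uniq ?s1 //.
  by move: u0; rewrite cat_uniq => /and3P[].
by rewrite /attach iq bS dS -er /w0 /= !delete_atK.
Qed.

End Words.

(** * The Elder Rule for a presented Morse set *)

Section OldestChains.
Variables (R : realType) (U : choiceType) (S : Defs.pset R U).
Implicit Types (P C : set (U * R)) (p : U * R).

(** Of two different oldest chains, each would contain a time before all times of the other. *)
Lemma oldest_chain_uniq P p C C' :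
  oldest_chain S P p C -> oldest_chain S P p C' -> C = C'.
Proof.
move=> [mC Cp oC] [mC' Cp' oC']; apply/eqP/negPn/negP => /eqP ne.
have [t [q Cq <-] ht] := oC _ mC' Cp' (nesym ne).
have [t' [q' Cq' <-] ht'] := oC' _ mC Cp ne.
have h1 : q.2 < q'.2 by apply: ht; exists q'.
have h2 : q'.2 < q.2 by apply: ht'; exists q.
by have := lt_trans h1 h2; rewrite ltxx.
Qed.

End OldestChains.

(** The points may coincide, so this serves both at deaths, with two branches, and elsewhere, with
    one. *)
Lemma subset_pair_card (T : choiceType) (A : set T) (x y : T) :
  A `<=` [set x; y] -> exists2 k, (k <= 2)%N & A #= `I_k.
Proof.
move=> sA; have [Ax|nx] := pselect (A x); have [Ay|ny] := pselect (A y).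
- have [xy|xy] := eqVneq x y.
    exists 1%N => //; have -> : A = [set x] by apply/seteqP; split => [z /sA[]|z ->] //; rewrite xy.
    by rewrite card_set1.
  exists 2%N => //; have -> : A = [set x; y] by apply/seteqP; split => // z [->|->].
  apply/card_set_bijP; exists (fun z => if z == x then 0%N else 1%N); split.
  - by move=> z /= _; case: ifP.
  - move=> z z'; rewrite !inE /= => -[->|->] [->|->] //; by rewrite eqxx // eq_sym (negbTE xy).
  - move=> [_|[_|//]] /=; [exists x; first by left|exists y; first by right].
      by rewrite eqxx.
    by rewrite eq_sym (negbTE xy).
- exists 1%N => //; have -> : A = [set x].
    by apply/seteqP; split => [z Az|z -> //]; case: (sA _ Az) => // zy; rewrite zy in Az.
  by rewrite card_set1.
- exists 1%N => //; have -> : A = [set y].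
    by apply/seteqP; split => [z Az|z -> //]; case: (sA _ Az) => // zy; rewrite zy in Az.
  by rewrite card_set1.
- exists 0%N => //; rewrite II0; have -> : A = set0; last exact: card_eq00.
  by apply/seteqP; split => // z Az; case: (sA _ Az) => zE; move: Az; rewrite zE.
Qed.

Lemma times_locate (R : realType) (tau : seq R) t : (0 < size tau)%N -> nth 0 tau 0 <= t ->
  exists i, [/\ (i < size tau)%N, nth 0 tau i <= t &
    ((i.+1 < size tau)%N -> t < nth 0 tau i.+1)].
Proof.
move=> n0 t0; have ex : exists i, (i < size tau)%N && (nth 0 tau i <= t) by exists 0%N; rewrite n0.
have ub i : (i < size tau)%N && (nth 0 tau i <= t) -> (i <= size tau)%N by lia.
case: (ex_maxnP ex ub) => i /andP[hi it] mx; exists i; split => // hi'.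
by rewrite ltNge; apply/negP => h; have := mx i.+1; rewrite hi' h ltnn => /(_ isT).
Qed.

(** On a bounded interval the shift is [eta t] after the inverse of [eta r]; on the last one, where
    no [eta] is given, both stages are single points. *)
Lemma interval_bij (R : realType) (U : choiceType) (S : Defs.pset R U) (tau : seq R) i r t :
  functorial S -> morse_times S tau -> (i < size tau)%N -> nth 0 tau i <= r -> r <= t ->
  ((i.+1 < size tau)%N -> t < nth 0 tau i.+1) ->
  set_bij (stage S r) (stage S t) (Defs.shift S r t).
Proof.
move=> [h _ _] [n0 [srt [emp [cst [fin _]]]]] hi ir rt ti.
have it := le_trans ir rt.
have [hi'|hi'] := ltnP i.+1 (size tau).
  have [eta [bij nat]] := cst _ hi'.
  have [f1 i1 s1] := bij r ltac:(by rewrite ir (le_lt_trans rt (ti hi'))).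
  have [f2 i2 s2] := bij t ltac:(by rewrite it (ti hi')).
  have sh x : stage S (nth 0 tau i) x -> Defs.shift S r t (eta r x) = eta t x.
    by move=> hx; apply: nat => //; exact: ti.
  split.
  - by move=> x /s1[y hy <-]; rewrite /= sh //; apply: f2.
  - move=> x y; rewrite !inE => /s1[x' hx <-] /s1[y' hy <-]; rewrite !sh // => e.
    by congr (eta r _); apply: i2; rewrite ?inE.
  - by move=> x /s2[y hy <-]; exists (eta r y); [exact: f1|exact: sh].
have iE : i = (size tau).-1 by lia.
rewrite iE in ir it.
have [x hx] := fin r ir; have [y hy] := fin t it.
have sx : Defs.shift S r t x = y.
  by have := h r t x rt; rewrite hx hy; apply.
rewrite hx hy; split.
- by move=> z ->; exact: sx.
- by move=> z z'; rewrite !inE => -> ->.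
- by move=> z ->; exists x.
Qed.

Section Presented.
Variables (R : realType) (U : choiceType) (b d : nat -> R) (n : nat)
  (rep : R -> nat -> nat).
Hypotheses (ok : bars_ok b d n) (el : elder b d n rep).
Implicit Types (S : Defs.pset R U) (c : R -> nat -> U) (tau : seq R).

(** [c t k] names the component at time t of the k-th birth; a component has one name for each birth
    in it. *)
Record presented S c := Presented {
  presented_stage : forall t x, stage S t x <->
    exists k, [/\ (k <= n)%N, b k <= t & x = c t k];
  presented_eq : forall t k l, (k <= n)%N -> (l <= n)%N -> b k <= t -> b l <= t ->
    c t k = c t l <-> rep t k = rep t l;
  presented_shift : forall r t k, (k <= n)%N -> b k <= r -> r <= t ->
    Defs.shift S r t (c r k) = c t k
}.

Definition crit : seq R :=
  sort <=%O ([seq b k | k <- iota 0 n.+1] ++ [seq d k | k <- iota 1 n]).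

Lemma mem_crit x : reflect
  ((exists2 k, (k <= n)%N & x = b k) \/ (exists2 k, (0 < k <= n)%N & x = d k))
  (x \in crit).
Proof.
rewrite mem_sort mem_cat; apply: (iffP orP).
  by case=> /mapP[k]; rewrite mem_iota => hk ->; [left|right]; exists k => //; lia.
by case=> -[k hk ->]; [left|right]; apply: map_f; rewrite mem_iota; lia.
Qed.

Lemma birth_crit k : (k <= n)%N -> b k \in crit.
Proof. by move=> hk; apply/mem_crit; left; exists k. Qed.

Lemma death_crit k : (0 < k <= n)%N -> d k \in crit.
Proof. by move=> hk; apply/mem_crit; right; exists k. Qed.

Lemma crit_sorted : sorted (fun x y : R => x < y) crit.
Proof.
rewrite -/(sorted <%O crit) lt_sorted_uniq_le sort_le_sorted andbT sort_uniq.
rewrite cat_uniq (uniq_births ok) // (uniq_deaths ok) andbT andTb.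
apply/hasPn => x /mapP[j]; rewrite mem_iota => hj ->.
apply/mapP => -[i]; rewrite mem_iota => hi /esym.
by apply: (birth_neq_death ok); lia.
Qed.

Lemma elder_le0 t k : (k <= n)%N -> b k <= t -> (rep t k <= n)%N.
Proof. by move=> hk hb; apply: (leq_trans _ hk); exact: (elder_le el). Qed.

Lemma elder_ble t k : (k <= n)%N -> b k <= t -> b (rep t k) <= t.
Proof. by move=> hk hb; apply: (le_trans _ hb); exact: (elder_birth el). Qed.

Lemma elder_rep t k : (k <= n)%N -> b k <= t -> rep t (rep t k) = rep t k.
Proof. by move=> hk hb; apply: (elder_comp el). Qed.

Lemma elder_rep0 t : b 0%N <= t -> rep t 0 = 0%N.
Proof. by move=> hb; apply/eqP; rewrite -leqn0; apply: (elder_le el). Qed.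

Lemma elder_fixed t k : (k <= n)%N -> b k <= t -> ((0 < k)%N -> t < d k) -> rep t k = k.
Proof.
move=> hk hb td; case: (posnP k) hb => [-> hb|k0 hb]; first exact: elder_rep0.
exact: (elder_id el) (td k0).
Qed.

Lemma elder_fixed_death t k : (k <= n)%N -> b k <= t -> rep t k = k -> (0 < k)%N -> t < d k.
Proof. by move=> hk hb e k0; have := elder_death el hk hb; rewrite e; apply. Qed.

Lemma elder_birth_lt t k : (k <= n)%N -> b k <= t -> rep t k <> k -> b (rep t k) < b k.
Proof.
move=> hk hb ne; rewrite lt_neqAle (elder_birth el) // andbT; apply/eqP => e.
by apply: ne; apply: (births_inj ok) => //; exact: elder_le0.
Qed.

(** The representative at r is alive there; with no death in between it is alive at t too, and there
    it represents k by [elder_comp]. *)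
Lemma elder_const r t k : (k <= n)%N -> b k <= r -> r <= t ->
  (forall j, (0 < j <= n)%N -> r < d j -> t < d j) -> rep t k = rep r k.
Proof.
move=> hk hb rt nod; rewrite -(elder_comp el hk hb rt).
apply: elder_fixed; first exact: elder_le0.
  by apply: (le_trans _ rt); exact: elder_ble.
move=> r0; apply: nod; first by rewrite r0 elder_le0.
exact: (elder_death el).
Qed.

Lemma crit_le i j : (i <= j < size crit)%N -> nth 0 crit i <= nth 0 crit j.
Proof.
case/andP=> ij hj; rewrite (lt_sorted_leq_nth 0 crit_sorted) // inE.
exact: leq_ltn_trans hj.
Qed.

Lemma crit_lt i j : (i < j < size crit)%N -> nth 0 crit i < nth 0 crit j.
Proof.
case/andP=> ij hj; rewrite (lt_sorted_ltn_nth 0 crit_sorted) // inE.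
exact: ltn_trans hj.
Qed.

Lemma crit_between i x t : (i.+1 < size crit)%N -> x \in crit ->
  x <= t -> t < nth 0 crit i.+1 -> x <= nth 0 crit i.
Proof.
move=> hi /(nthP 0)[j hj <-] xt ti.
have [ij|ji] := ltnP i j; last by apply: crit_le; rewrite ji ltnW.
by have := le_lt_trans xt ti; rewrite ltNge crit_le // ij.
Qed.

Variables (S : Defs.pset R U) (c : R -> nat -> U).
Hypothesis pr : presented S c.

Lemma stage_c t k : (k <= n)%N -> b k <= t -> stage S t (c t k).
Proof. by move=> hk hb; apply/(presented_stage pr); exists k. Qed.

Lemma c_inj t k l : (k <= n)%N -> (l <= n)%N -> b k <= t -> b l <= t ->
  c t k = c t l -> rep t k = rep t l.
Proof. by move=> hk hl hb hb' /(presented_eq pr) ->. Qed.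

Lemma stage_alive t x : stage S t x ->
  exists k, [/\ (k <= n)%N, b k <= t, rep t k = k & x = c t k].
Proof.
move=> /(presented_stage pr)[k [hk hb ->]]; exists (rep t k).
split; [exact: elder_le0|exact: elder_ble|exact: elder_rep|].
apply/(presented_eq pr) => //; [exact: elder_le0|exact: elder_ble|].
by rewrite elder_rep.
Qed.

Lemma presented_functorial : functorial S.
Proof.
split.
- move=> r t x rt /(presented_stage pr)[k [hk hb ->]].
  by rewrite (presented_shift pr) //; apply: stage_c => //; apply: (le_trans _ rt).
- by move=> t x /(presented_stage pr)[k [hk hb ->]]; rewrite (presented_shift pr).
- move=> r s t x rs st /(presented_stage pr)[k [hk hb ->]].
  by rewrite !(presented_shift pr) // ?(le_trans hb) // (le_trans rs).
Qed.

Lemma presented_finite t : finite_set (stage S t).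
Proof.
apply: (@sub_finite_set _ _ (c t @` `I_n.+1)).
  by move=> x /(presented_stage pr)[k [hk hb ->]]; exists k.
exact/finite_image/finite_II.
Qed.

(* The part of the poset carried by the bars of index at least J: what the
   Elder Rule leaves after J steps. *)
Definition later_bars (J : nat) : set (U * R) :=
  [set p | exists k, [/\ (J <= k <= n)%N, b k <= p.2, rep p.2 k = k & p.1 = c p.2 k]].

(** The upward path of the birth of bar j, as far as it stays in what is left. For J = 0 it never
    stops; for J = j > 0 it stops at the death of j, where it enters the chain of an earlier bar. *)
Definition bar_chain (J j : nat) : set (U * R) :=
  [set p | [/\ b j <= p.2, p.1 = c p.2 j & later_bars J p]].

Lemma later_bars0 : later_bars 0 = poset_of S.
Proof.
apply/seteqP; split => [[x t] [k [/= hk hb _ ->]]|[x t]]; first exact: stage_c.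
by case/stage_alive=> k [/= hk hb e xE]; exists k; rewrite hk.
Qed.

(** Nothing lies strictly below the birth of j: it would sit on a bar absorbed by j, and absorbed
    bars are born after the bar that absorbs them. *)
Lemma bar_chain_comparable J j q : (J <= j <= n)%N -> later_bars J q ->
  prec S q (c (b j) j, b j) \/ prec S (c (b j) j, b j) q -> bar_chain J j q.
Proof.
move=> hj; case: q => x s [i [hi /= hb e ->]] /= cmp.
have jn : (j <= n)%N by lia.
have iN : (i <= n)%N by lia.
have bj : rep (b j) j = j.
  by apply: elder_fixed => // j0; apply: (birth_lt_death ok); lia.
case: cmp => -[/= le]; rewrite (presented_shift pr) //.
  move/(c_inj iN jn (le_trans hb le) (lexx _)); rewrite bj => ej.
  suff eij : i = j by subst i; split => //=; exists j.
  apply: contrapT => ne; suff : b j < b i by rewrite ltNge (le_trans hb).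
  by rewrite -[X in b X < _]ej; apply: elder_birth_lt; rewrite ?ej ?(le_trans hb le) //; apply/nesym.
by move=> ej; split => //=; exists i.
Qed.

(** Maximality follows by comparing with the birth of j. A rival chain through the same element
    stays after [b j]: an element of it at time [b j] or before would be the birth of j itself,
    which forces the rival into [bar_chain]. *)
Lemma bar_chain_oldest J j t : (J <= j <= n)%N -> b j <= t -> rep t j = j ->
  oldest_chain S (later_bars J) (c t j, t) (bar_chain J j).
Proof.
move=> hj ht et; have jn : (j <= n)%N by lia.
have bj : rep (b j) j = j.
  by apply: elder_fixed => // j0; apply: (birth_lt_death ok); lia.
have cpt : bar_chain J j (c t j, t) by split => //=; exists j.
have cpb : bar_chain J j (c (b j) j, b j) by split => //=; exists j.
have ch : chain S (later_bars J) (bar_chain J j).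
  split => [p []//|[x s] [y s'] [/= h1 -> _] [/= h2 -> _]].
  rewrite /prec /=; have [ss|/ltW ss] := leP s s'; [left|right];
    by rewrite (presented_shift pr).
have mx : maximal_chain S (later_bars J) (bar_chain J j).
  split=> // C' [sC' cC'] sub; apply/seteqP; split => // q Cq.
  by apply: bar_chain_comparable (sC' _ Cq) (cC' _ _ Cq (sub _ cpb)).
split => // C' [[sC' cC'] mC'] C't ne; exists (b j); first by exists (c (b j) j, b j).
move=> _ [[x s] Cq <-] /=; rewrite ltNge; apply/negP => sj.
have qb : (x, s) = (c (b j) j, b j).
  have [i [hi /= hb e xE]] := sC' _ Cq.
  have iN : (i <= n)%N by lia.
  have it : b i <= t by rewrite (le_trans hb) // (le_trans sj).
  have ei : rep t i = j.
    case: (cC' _ _ Cq C't) => -[/= le].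
      rewrite xE (presented_shift pr) // => /(c_inj iN jn it ht).
      by rewrite et.
    have st : s = t by apply/le_anti; rewrite le (le_trans sj).
    rewrite xE st (presented_shift pr) // => /esym/(c_inj iN jn it ht).
    by rewrite et.
  have eij : i = j.
    apply: contrapT => ne'; suff : b j < b i by rewrite ltNge (le_trans hb).
    by rewrite -[X in b X < _]ei; apply: elder_birth_lt; rewrite ?ei // => /esym.
  have sb : s = b j by apply/le_anti; rewrite sj -eij hb.
  by rewrite xE eij sb.
apply: ne; symmetry; apply: mC' => // q C'q.
by apply: bar_chain_comparable (sC' _ C'q) _ => //; rewrite -qb; apply: cC'.
Qed.

Lemma presented_morse_times : morse_times S crit.
Proof.
have last_ub x : x \in crit -> x <= nth 0 crit (size crit).-1.
  by move=> /(nthP 0)[j hj <-]; apply: crit_le; rewrite -ltnS (ltn_predK hj) hj leqnn.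
have szc : (0 < size crit)%N by move: (birth_crit (leq0n n)); case: crit.
split; [|split; [|split; [|split; [|split; [|split]]]]] => //.
- exact: crit_sorted.
- move=> t t0; apply/seteqP; split => // x /(presented_stage pr)[k [hk hb _]] /=.
  move: (birth_crit hk) => /(nthP 0)[j hj e].
  have : nth 0 crit 0 <= b k by rewrite -e; apply: crit_le.
  by rewrite leNgt (le_lt_trans hb t0).
(* The natural isomorphism is the shift from the left end s: with no birth inside the interval it is
   surjective, with no death there it is injective. *)
- move=> i hi; set s := nth 0 crit i.
  have nod t : t < nth 0 crit i.+1 -> forall j, (0 < j <= n)%N -> s < d j -> t < d j.
    move=> ti j hj; rewrite ltNge => sd; rewrite ltNge; apply/negP => dt.
    by move/negP: sd; apply; apply: crit_between ti => //; exact: death_crit.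
  exists (fun t x => Defs.shift S s t x); split.
    move=> t /andP[st ti]; split.
    + by move=> x; apply: (let: And3 h _ _ := presented_functorial in h).
    + move=> x y; rewrite !inE => /(presented_stage pr)[k [hk hb ->]] /(presented_stage pr)[l [hl hb' ->]].
      rewrite !(presented_shift pr) // => /(presented_eq pr) h; apply/(presented_eq pr) => //.
      rewrite -(elder_const hk hb st (nod _ ti)) -(elder_const hl hb' st (nod _ ti)).
      by apply: h => //; rewrite (le_trans _ st).
    + move=> x /(presented_stage pr)[k [hk hb ->]].
      have hb' : b k <= s by apply: crit_between ti => //; exact: birth_crit.
      by exists (c s k); [exact: stage_c|rewrite (presented_shift pr)].
  move=> r t x sr rt _; have [_ _ h] := presented_functorial; exact: h.
(* From the last critical time on, only the infinite bar is alive. *)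
- move=> t ht; exists (c t 0%N).
  have b0 : b 0%N <= t by rewrite (le_trans _ ht) // last_ub // birth_crit.
  apply/seteqP; split => [x /stage_alive[k [hk hb e ->]]|x ->]; last exact: stage_c.
  case: (posnP k) => [-> //|k0]; have := elder_death el hk hb; rewrite e => /(_ k0).
  by rewrite ltNge (le_trans _ ht) // last_ub // death_crit // k0.
(* A bar l alive at s and carried to bar k is k itself or dies exactly at s'. Deaths are distinct,
   so besides k there is at most one such bar. *)
- move=> i x hi /stage_alive[k [hk hb e ->]]; set s := nth 0 crit i; set s' := nth 0 crit i.+1.
  have ss' : s < s' by apply: crit_lt; lia.
  have [[j [hj dj]]|nj] := pselect (exists j, (0 < j <= n)%N /\ d j = s').
    apply: (@subset_pair_card _ _ (c s k) (c s j)) => y [/stage_alive[l [hl hl' el' ->]]].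
    rewrite (presented_shift pr) ?(ltW ss') // => /c_inj.
    rewrite e => /(_ hl hk (le_trans hl' (ltW ss')) hb) lk.
    have [<-|ne] := eqVneq l k; first by left.
    right; congr (c s _).
    have l0 : (0 < l)%N.
      rewrite lt0n; apply: contra_neq ne => l0; rewrite -lk l0 elder_rep0 // -l0.
      exact: (le_trans _ (ltW ss')).
    apply: contrapT => lj.
    have dl : d l = s'.
      apply/le_anti/andP; split.
        rewrite leNgt; apply/negP => sd; move: ne; rewrite -lk.
        by rewrite (elder_id el) ?eqxx // (le_trans hl' (ltW ss')).
      rewrite leNgt; apply/negP => ds.
      have : d l <= s by apply: (crit_between hi) ds; rewrite ?death_crit ?l0.
      by rewrite leNgt elder_fixed_death.
    have [jl|lj'|jl] := ltngtP j l; last by rewrite jl in lj.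
    + by have := deaths_decr ok (i:=j) (j:=l); rewrite dl dj ltxx; natlia.
    + by have := deaths_decr ok (i:=l) (j:=j); rewrite dl dj ltxx; natlia.
  apply: (@subset_pair_card _ _ (c s k) (c s k)) => y [/stage_alive[l [hl hl' el' ->]]].
  rewrite (presented_shift pr) ?(ltW ss') // => /c_inj.
  rewrite e => /(_ hl hk (le_trans hl' (ltW ss')) hb) lk; left; congr (c s _); rewrite -lk.
  apply/esym/elder_fixed => //; first exact: (le_trans _ (ltW ss')).
  move=> l0; rewrite ltNge; apply/negP => ds.
  have dl : d l < s'.
    by rewrite lt_neqAle ds andbT; apply/eqP => e'; apply: nj; exists l; rewrite l0.
  have : d l <= s by apply: (crit_between hi) dl; rewrite ?death_crit ?l0.
  by rewrite leNgt elder_fixed_death.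
- move=> t y /stage_alive[k [hk hb e ->]]; exists (bar_chain 0 k); split.
    by rewrite -later_bars0; apply: bar_chain_oldest.
  move=> C; apply: oldest_chain_uniq; rewrite -later_bars0.
  exact: bar_chain_oldest.
Qed.

Lemma morse_times_bij tau v : morse_times S tau -> v \notin tau ->
  stage S v = set0 \/ exists2 s, s < v & forall r, s <= r -> r <= v ->
    set_bij (stage S r) (stage S v) (Defs.shift S r v).
Proof.
move=> mt vt; have [n0 [srt [emp _]]] := mt.
have [v0|v0] := ltP v (nth 0 tau 0); first by left; apply: emp.
right; have [i [hi iv vi]] := times_locate n0 v0.
have iv' : nth 0 tau i < v.
  by rewrite lt_neqAle iv andbT; apply: contraNneq vt => <-; rewrite mem_nth.
exists (nth 0 tau i) => // r ir rv.
exact: (interval_bij presented_functorial mt hi ir rv vi).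
Qed.

(** A birth breaks surjectivity of the shift into its time, a death breaks injectivity, and a time
    outside [tau] has both. Hence [crit] is minimal. *)
Lemma morse_times_crit tau : morse_times S tau -> {subset crit <= tau}.
Proof.
move=> mt v /mem_crit cv; apply: contrapT => /negP vt.
have [e|[s sv bij]] := morse_times_bij mt vt.
  have [k [hk hb]] : exists k, (k <= n)%N /\ b k <= v.
    case: cv => -[k hk ->]; exists k; split => //; first lia.
    by apply/ltW/(birth_lt_death ok).
  by have := stage_c hk hb; rewrite e.
have bv k : v = b k -> b k <= v by move=> ->.
case: cv => -[k hk vE].
  have [_ _ sur] := bij s (lexx _) (ltW sv).
  have [/= x hx] := sur _ (stage_c hk (bv _ vE)).
  move: hx => /(presented_stage pr)[j [hj hb ->]]; rewrite (presented_shift pr) ?(ltW sv) //.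
  have bj : b j < b k by rewrite -vE (le_lt_trans hb).
  move/(c_inj hj hk (le_trans hb (ltW sv)) (bv _ vE)).
  have -> : rep v k = k.
    apply: elder_fixed => //; first by rewrite vE.
    by move=> k0; rewrite vE; apply: (birth_lt_death ok); rewrite k0.
  move=> e; have := elder_birth el hj (le_trans hb (ltW sv)).
  by rewrite e leNgt bj.
have hkn : (k <= n)%N by lia.
have bk : b k < v by rewrite vE; apply: (birth_lt_death ok).
set j := rep v k.
have jk : j <> k.
  have jd := @elder_death _ _ _ _ _ el v k hkn (ltW bk).
  by move=> e; move: jd; rewrite -/j e vE ltxx; natlia.
have jn : (j <= n)%N by apply: elder_le0 => //; exact: ltW.
have bj : b j < b k by apply: elder_birth_lt => //; exact: ltW.
(* At r, before v but after both births, bar k and its absorber j are still different components,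
   while they agree at v. *)
set r := Order.max s (b k).
have rv : r < v by rewrite gt_max sv.
have br : b k <= r by rewrite le_max lexx orbT.
have [_ inj _] := bij r ltac:(by rewrite le_max lexx) (ltW rv).
have bjr : b j <= r by rewrite (le_trans (ltW bj)).
have : c r k = c r j.
  apply: inj; rewrite ?inE; [exact: stage_c|exact: stage_c|].
  rewrite !(presented_shift pr) ?(ltW rv) //; apply/(presented_eq pr) => //.
  - exact: ltW.
  - exact: (le_trans _ (ltW rv)).
  - by rewrite elder_rep // ltW.
move/(c_inj hkn jn br bjr).
rewrite (@elder_fixed r k) // -?vE //.
rewrite (@elder_fixed r j) //; first by move=> e; apply: jk.
move=> j0; apply: (lt_trans rv); apply: (elder_death el) => //; exact: ltW.
Qed.

Lemma presented_morse_axioms : morse_axioms S crit.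
Proof.
split; [exact: presented_functorial|exact: presented_finite|exact: presented_morse_times|].
move=> tau mt sub; have sub' := morse_times_crit mt.
have [_ [srt _]] := mt; apply: (irr_sorted_eq (leT:=<%O)) => //.
- exact: lt_trans.
- exact: crit_sorted.
- by move=> x; apply/idP/idP => [/sub|/sub'].
Qed.

Definition bar (j : nat) : set R :=
  if j == 0%N then `[b j, +oo[%classic else `[b j, d j[%classic.

Lemma proj_bar_chain j : (j <= n)%N -> proj_chain (bar_chain j j) = bar j.
Proof.
move=> hj; apply/seteqP; split.
  move=> _ [[x t] [/= hb -> [k [/= hk hk' e +]]] <-] /=.
  have kn : (k <= n)%N by lia.
  move/(c_inj hj kn hb hk'); rewrite e => ek.
  have kj : k = j by have := elder_le el hj hb; rewrite ek; lia.
  rewrite kj in e.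
  rewrite /bar; case: eqP => j0; rewrite /= in_itv /= hb //=.
  by apply: elder_fixed_death => //; lia.
move=> t ht; have [hb e] : b j <= t /\ rep t j = j.
  move: ht; rewrite /bar; case: (j =P 0%N) => [->|j0]; rewrite /= in_itv /= ?andbT.
    by move=> hb; split => //; apply: elder_rep0.
  by move=> /andP[hb td]; split => //; apply: (elder_id el) => //; lia.
by exists (c t j, t) => //; split => //=; exists j; rewrite leqnn.
Qed.

Lemma later_barsD j : later_bars j `\` bar_chain j j = later_bars j.+1.
Proof.
apply/seteqP; split => [[x t] [[k [hk hb e xE]] nb]|[x t] [k [hk hb e xE]]].
  have [kj|kj] := eqVneq k j; last by exists k; split => //; lia.
  by exfalso; apply: nb; subst k; split => //; exists j.
split; first by exists k; split => //; lia.
move=> [/= hb' xE' [l [hl /= hbl el' _]]].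
have jn : (j <= n)%N by lia.
have kn : (k <= n)%N by lia.
move: xE' xE => /= -> /(c_inj jn kn hb' hb).
by rewrite e => ek; have := elder_le el jn hb'; rewrite ek; lia.
Qed.

Lemma later_bars_last : later_bars n.+1 = set0.
Proof. by apply/seteqP; split => // p [k [hk]]; lia. Qed.

(** If the topmost remaining element lay on a bar i > j, its time would be less than [d i]. But bar
    j outlives i, so it is still alive at the later of [b j] and [d i], a time in [tau]. This is
    where the order of the deaths makes the Elder Rule pick the bars by index. *)
Lemma later_bars_top tau j p : {subset crit <= tau} -> (j <= n)%N -> later_bars j p ->
  (forall q, later_bars j q -> q.2 \in tau -> q.2 <= p.2) ->
  [/\ b j <= p.2, rep p.2 j = j & p.1 = c p.2 j].
Proof.
move=> sub hj [i [hi hb e pE]] mx.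
have [ij|ne] := eqVneq i j; first by subst i.
have i0 : (0 < i)%N by lia.
have di : p.2 < d i by apply: elder_fixed_death => //; lia.
have dji : (0 < j)%N -> d i < d j by move=> j0; apply: (deaths_decr ok) => //; lia.
pose t := Order.max (b j) (d i).
have bt : b j <= t by rewrite le_max lexx.
have et : rep t j = j.
  apply: elder_fixed => // j0; rewrite gt_max dji // andbT.
  by apply: (birth_lt_death ok); rewrite j0.
have : t <= p.2.
  apply: (mx (c t j, t)); first by exists j; rewrite leqnn.
  apply: sub; rewrite /= /t; case: leP => _; [apply: death_crit; lia|exact: birth_crit].
by rewrite leNgt lt_max di orbT.
Qed.

Lemma elder_run_presented tau P Cs : {subset crit <= tau} -> elder_run S tau P Cs ->
  forall j, (j <= n.+1)%N -> P = later_bars j ->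
  Cs = [seq bar_chain k k | k <- iota j (n.+1 - j)].
Proof.
move=> sub; elim=> {P Cs} [|P p C Cs Pp pt mx old run IH] j hj PE.
  have [jn|jn] := leqP j n; last by rewrite (_ : (n.+1 - j)%N = 0%N) //; lia.
  exfalso; rewrite -[False]/(@set0 (U * R) (c (b j) j, b j)) PE; exists j; split => //=.
    by rewrite leqnn.
  by apply: elder_fixed => // j0; apply: (birth_lt_death ok); rewrite j0.
have [jn|jn] := leqP j n; last first.
  by move: Pp; rewrite PE (_ : j = n.+1) ?later_bars_last //; lia.
subst P; have [hb e pE] := later_bars_top sub jn Pp mx.
have CE : C = bar_chain j j.
  apply: oldest_chain_uniq old _; rewrite [p]surjective_pairing pE.
  by apply: bar_chain_oldest => //; rewrite leqnn.
rewrite (_ : (n.+1 - j)%N = (n.+1 - j.+1).+1) /=; last lia.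
by rewrite CE; congr cons; apply: IH => //; rewrite CE later_barsD.
Qed.

Lemma presented_elder_run tau : {subset crit <= tau} ->
  elder_run S tau (poset_of S) [seq bar_chain k k | k <- iota 0 n.+1].
Proof.
move=> sub; rewrite -later_bars0.
suff h m : (m <= n.+1)%N ->
    elder_run S tau (later_bars (n.+1 - m)) [seq bar_chain k k | k <- iota (n.+1 - m) m].
  by have := h n.+1 (leqnn _); rewrite subnn.
elim: m => [|m IH] hm; first by rewrite subn0 later_bars_last; exact: elder_stop.
set j := (n.+1 - m.+1)%N; have jE : (n.+1 - m)%N = j.+1 by rewrite /j; lia.
have hj : (j <= n)%N by rewrite /j; lia.
have bj : later_bars j (c (b j) j, b j).
  exists j; split => //=; first by rewrite leqnn.
  by apply: elder_fixed => // j0; apply: (birth_lt_death ok); rewrite j0.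
have [p [jp pt mx]] : exists p, [/\ later_bars j p, p.2 \in tau &
    forall q, later_bars j q -> q.2 \in tau -> q.2 <= p.2].
  pose s := [seq t <- tau | `[< exists2 p, later_bars j p & p.2 = t >]].
  have bs : b j \in s.
    rewrite mem_filter sub ?birth_crit // andbT; apply/asboolP.
    by exists (c (b j) j, b j).
  (* The default value [b j] is itself in s, so the maximum is attained in s. *)
  pose T := \big[Order.max/b j]_(t <- s) t.
  have sT t : t \in s -> t <= T by move=> h; apply: le_bigmax_seq.
  have Ts : T \in s.
    suff h s' : all (mem s) s' -> \big[Order.max/b j]_(t <- s') t \in s by apply/h/allP.
    elim: s' => [|t s' IHs] /=; first by rewrite big_nil.
    by move=> /andP[ts /IHs hs]; rewrite big_cons /Order.max; case: ifP.
  move: (Ts); rewrite mem_filter => /andP[/asboolP[p jp pT] Ttau].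
  exists p; rewrite pT; split => // q jq qt; apply: sT.
  by rewrite mem_filter qt andbT; apply/asboolP; exists q.
have [hb e pE] := later_bars_top sub hj jp mx.
apply: (elder_step jp pt mx).
  by rewrite [p]surjective_pairing pE; apply: bar_chain_oldest => //; rewrite leqnn.
by rewrite later_barsD -jE; apply: IH; lia.
Qed.

Lemma map_proj_bar_chain : [seq proj_chain C | C <- [seq bar_chain k k | k <- iota 0 n.+1]]
  = [seq bar k | k <- iota 0 n.+1].
Proof.
rewrite -map_comp; apply/eq_in_map => k; rewrite mem_iota => /andP[_ hk] /=.
exact: proj_bar_chain.
Qed.

End Presented.

(** The times of S enter only through their containing [crit], which already fixes the chains of
    every run. *)
Lemma elder_rule_presented (R : realType) (U : choiceType) (b d : nat -> R) n rep c
    (S : morse_set R U) (B : barcode R) :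
  bars_ok b d n -> elder b d n rep -> presented b n rep S c ->
  elder_rule S B <-> forall J, B J = count_mem J [seq bar b d k | k <- iota 0 n.+1].
Proof.
move=> ok el pr; have [_ _ mt _] := ms_axioms S.
have sub := morse_times_crit ok el pr mt.
split=> [[Cs run cnt] J|cnt].
  have := elder_run_presented ok el pr sub run (leq0n _) (esym (later_bars0 el pr)).
  by rewrite subn0 => CsE; rewrite cnt CsE (map_proj_bar_chain el pr).
exists [seq bar_chain b n rep c k k | k <- iota 0 n.+1]; first exact: (presented_elder_run ok el pr).
by move=> J; rewrite (map_proj_bar_chain el pr).
Qed.

(** * Maps of the unit interval *)

Section UnitInterval.
Variable R : realType.
Implicit Types (f g : I01 R -> R) (p x y z : I01 R).

Lemma I01_bounds p : 0 <= set_val p <= 1.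
Proof. by have := set_valP p; rewrite /= in_itv. Qed.

Lemma I01_inj p x : set_val p = set_val x -> p = x.
Proof. exact: val_inj. Qed.

Lemma clamp_subproof (r : R) : Order.max 0 (Order.min r 1) \in (`[0, 1]%classic : set R).
Proof. by rewrite inE /= in_itv /= le_max lexx ge_max ler01 ge_min lexx orbT. Qed.

(** A retraction of the line onto the interval. Composing with it turns maps on the subtype into
    maps on the line, where the intermediate value theorem and explicit formulas are available. *)
Definition clamp (r : R) : I01 R := SigSub (clamp_subproof r).

Lemma val_clampE r : set_val (clamp r) = Order.max 0 (Order.min r 1).
Proof. by []. Qed.

Lemma val_clamp r : 0 <= r <= 1 -> set_val (clamp r) = r.
Proof.
by move=> /andP[r0 r1]; rewrite val_clampE (min_idPl r1) (max_idPr r0).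
Qed.

Lemma clampK p : clamp (set_val p) = p.
Proof. by apply/I01_inj/val_clamp/I01_bounds. Qed.

Lemma near_I01 p (P : I01 R -> Prop) : (\forall x \near p, P x) <->
  exists2 e, 0 < e & forall x, `|set_val x - set_val p| < e -> P x.
Proof.
split.
  case=> V [[W oW <-] /= Wp sub].
  have /nbhs_ballP[e /= e0 h] : nbhs (set_val p) W by apply: open_nbhs_nbhs.
  by exists e => // x hx; apply/sub/h; rewrite /ball /= distrC.
case=> e e0 h; exists (set_val @^-1` ball (set_val p) e); split => /=.
- by exists (ball (set_val p) e) => //; exact: ball_open.
- exact: ballxx.
- by move=> x; rewrite /ball /= distrC => /h.
Qed.

Lemma continuous_to_I01 (T : topologicalType) (g : T -> I01 R) :
  continuous (set_val \o g : T -> R) -> continuous g.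
Proof.
move=> cg t V /near_I01[e e0 h].
have /cvgr_dist_lt /(_ _ e0) := cg t.
by apply: filterS => s hs; apply: h; rewrite distrC.
Qed.

Lemma continuous_set_val : continuous (set_val : I01 R -> R).
Proof.
move=> p V /nbhs_ballP[e /= e0 h]; apply/near_I01; exists e => // x.
by rewrite distrC => hx; apply: h.
Qed.

Lemma continuous_I01P f : continuous f <-> forall p e, 0 < e ->
  exists2 r, 0 < r & forall x, `|set_val x - set_val p| < r -> `|f x - f p| < e.
Proof.
split=> [cf p e e0|h p].
  have /cvgr_dist_lt /(_ _ e0) /near_I01[r r0 hr] := cf p.
  by exists r => // x hx; rewrite distrC; apply: hr.
move=> V /nbhs_ballP[e /= e0 sub]; apply/near_I01; have [r r0 hr] := h p e e0.
by exists r => // x hx; apply: sub; rewrite /ball /= distrC; apply: hr.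
Qed.

Lemma continuous_clamp : continuous clamp.
Proof.
apply: continuous_to_I01 => r; apply/cvgrPdist_lt => e e0; near=> s.
have : `|r - s| < e by near: s; exact: cvgr_dist_lt.
apply: le_lt_trans; rewrite /comp !val_clampE.
have := ler_norm (r - s); have := ler_norm (s - r); rewrite distrC ler_norml.
case: (leP r 1) => r1; case: (leP s 1) => s1; rewrite ?(max_idPr ler01) //.
- by case: (leP 0 r) => ?; case: (leP 0 s) => ?; lra.
- by case: (leP 0 r) => ?; lra.
- by case: (leP 0 s) => ?; lra.
- by lra.
Unshelve. all: by end_near. Qed.

Lemma IVT_I01 f x y v : continuous f -> set_val x <= set_val y ->
  Order.min (f x) (f y) <= v <= Order.max (f x) (f y) ->
  exists2 z, set_val x <= set_val z <= set_val y & f z = v.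
Proof.
move=> cf xy hv.
have cF : continuous (f \o clamp).
  by move=> r; apply: continuous_comp; [exact: continuous_clamp|exact: cf].
have := @IVT R (f \o clamp) (set_val x) (set_val y) v xy (continuous_subspaceT cF).
rewrite /= !clampK => /(_ hv)[r]; rewrite in_itv /= => /andP[xr ry] <-.
exists (clamp r) => //; rewrite val_clamp ?xr //.
have /andP[x0 _] := I01_bounds x; have /andP[_ y1] := I01_bounds y.
by rewrite (le_trans x0 xr) (le_trans ry y1).
Qed.

Definition below_between f (t : R) x y := forall z,
  (set_val x <= set_val z <= set_val y) || (set_val y <= set_val z <= set_val x) -> f z <= t.

(** By the intermediate value theorem a path passes through every point between its ends; conversely
    the segment between them is a path. *)
Lemma path_in_sublevel f t x y : Defs.path_in R (sublevel f t) x y <-> below_between f t x y.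
Proof.
split=> [[g [cg g0 g1 rg]] z hz|h].
  have cg' : continuous (set_val \o g).
    by move=> s; apply: continuous_comp; [exact: cg|exact: continuous_set_val].
  have v01 : set_val (I0 R) <= set_val (I1 R) by rewrite /= ler01.
  have [|s _ hs] := IVT_I01 (v:=set_val z) cg' v01.
    by rewrite /= g0 g1 ge_min le_max; case/orP: hz => /andP[-> ->]; rewrite ?orbT.
  by rewrite -(I01_inj hs); apply: rg; exists s.
pose L (s : R) := set_val x + s * (set_val y - set_val x).
have L01 s : 0 <= s <= 1 -> (set_val x <= L s <= set_val y) || (set_val y <= L s <= set_val x).
  move=> hs; rewrite /L; have [xy|/ltW yx] := leP (set_val x) (set_val y).
    by apply/orP; left; nra.
  by apply/orP; right; nra.
have L01' s : 0 <= s <= 1 -> 0 <= L s <= 1.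
  move=> /L01; have /andP[? ?] := I01_bounds x; have /andP[? ?] := I01_bounds y.
  by case/orP; lra.
exists (clamp \o L \o set_val); split.
- move=> s; apply: continuous_comp; first exact: continuous_set_val.
  apply: continuous_comp; last exact: continuous_clamp.
  apply: cvgD; first exact: cvg_cst.
  by apply: cvgM; [exact: cvg_id|exact: cvg_cst].
- by rewrite /= /L mul0r addr0 clampK.
- by rewrite /= /L mul1r subrKC clampK.
- by move=> _ [s _ <-]; apply: h; rewrite /= val_clamp ?L01 ?L01' ?I01_bounds.
Qed.

(** The preimages of [phi p - e] and [phi p + e] bound a neighbourhood of p; where such a value
    leaves the unit interval, that side imposes no constraint and any radius will do. *)
Lemma increasing_bij_continuous (phi psi : I01 R -> I01 R) :
  cancel phi psi -> cancel psi phi ->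
  (forall x y, set_val x < set_val y -> set_val (phi x) < set_val (phi y)) ->
  continuous phi.
Proof.
move=> K K' inc; apply: continuous_to_I01; apply/continuous_I01P => p e e0.
have inc' x y : set_val (phi x) < set_val (phi y) -> set_val x < set_val y.
  move=> h; rewrite ltNge le_eqVlt; apply/negP => /orP[/eqP/I01_inj E|/inc].
    by rewrite E ltxx in h.
  by rewrite ltNge (ltW h).
have /andP[q0 q1] := I01_bounds (phi p).
have [r1 r10 h1] : exists2 r, 0 < r & forall x, set_val p - r < set_val x ->
    set_val (phi p) - e < set_val (phi x).
  have [lt0|ge0] := ltP (set_val (phi p) - e) 0.
    by exists 1 => // x _; have /andP[? _] := I01_bounds (phi x); lra.
  have v : set_val (clamp (set_val (phi p) - e)) = set_val (phi p) - e.
    by rewrite val_clamp //; lra.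
  set y := clamp _ in v; exists (set_val p - set_val (psi y)).
    by rewrite subr_gt0; apply: inc'; rewrite K' v; lra.
  by move=> x; rewrite subKr => /inc; rewrite K' v.
have [r2 r20 h2] : exists2 r, 0 < r & forall x, set_val x < set_val p + r ->
    set_val (phi x) < set_val (phi p) + e.
  have [lt0|ge0] := ltP 1 (set_val (phi p) + e).
    by exists 1 => // x _; have /andP[_ ?] := I01_bounds (phi x); lra.
  have v : set_val (clamp (set_val (phi p) + e)) = set_val (phi p) + e.
    by rewrite val_clamp //; lra.
  set y := clamp _ in v; exists (set_val (psi y) - set_val p).
    by rewrite subr_gt0; apply: inc'; rewrite K' v; lra.
  by move=> x; rewrite subrKC => /inc; rewrite K' v.
exists (Order.min r1 r2); first by rewrite lt_min r10.
move=> x; rewrite lt_min !ltr_distl => /andP[/andP[x1 _] /andP[_ x2]].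
by rewrite /= h1 ?h2.
Qed.

Lemma increasing_homeoP (phi psi : I01 R -> I01 R) :
  cancel phi psi -> cancel psi phi ->
  (forall x y, set_val x < set_val y -> set_val (phi x) < set_val (phi y)) ->
  increasing_homeo phi.
Proof.
move=> K K' inc; exists psi; split => //; first exact: increasing_bij_continuous K K' inc.
apply: (increasing_bij_continuous K' K) => x y xy.
rewrite ltNge le_eqVlt; apply/negP => /orP[/eqP/I01_inj E|/inc].
  by rewrite -(K' x) -E K' ltxx in xy.
by rewrite !K' ltNge (ltW xy).
Qed.

Lemma increasing_homeo_id : increasing_homeo (@id (I01 R)).
Proof. exact: (@increasing_homeoP id id). Qed.

Lemma increasing_homeo_inv (phi : I01 R -> I01 R) : increasing_homeo phi ->
  exists psi, [/\ cancel phi psi, cancel psi phi & increasing_homeo psi].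
Proof.
case=> psi [c1 c2 K K' inc]; exists psi; split => //.
apply: (increasing_homeoP K' K) => x y xy.
rewrite ltNge le_eqVlt; apply/negP => /orP[/eqP/I01_inj E|/inc].
  by rewrite -(K' x) -E K' ltxx in xy.
by rewrite !K' ltNge (ltW xy).
Qed.

Lemma increasing_homeo_comp (phi psi : I01 R -> I01 R) :
  increasing_homeo phi -> increasing_homeo psi -> increasing_homeo (phi \o psi).
Proof.
case=> phi' [_ _ K1 K1' i1] [psi' [_ _ K2 K2' i2]].
apply: (@increasing_homeoP _ (psi' \o phi')).
- by move=> x /=; rewrite K1 K2.
- by move=> x /=; rewrite K2' K1'.
- by move=> x y xy /=; apply/i1/i2.
Qed.

Lemma graph_equiv_refl f : graph_equiv f f.
Proof. by exists id => //; exact: increasing_homeo_id. Qed.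

Lemma graph_equiv_sym f g : graph_equiv f g -> graph_equiv g f.
Proof.
case=> phi /increasing_homeo_inv[psi [K K' hpsi]] ->; exists psi => //.
by apply: funext => x /=; rewrite K'.
Qed.

Lemma graph_equiv_trans f g (h : I01 R -> R) :
  graph_equiv f g -> graph_equiv g h -> graph_equiv f h.
Proof.
case=> phi hphi -> [psi hpsi ->]; exists (psi \o phi) => //.
exact: increasing_homeo_comp.
Qed.

Lemma graph_classP f g : graph_class f = graph_class g <-> graph_equiv f g.
Proof.
split=> [e|fg].
  by change (graph_class f g); rewrite e; exact: graph_equiv_refl.
apply/seteqP; split => h; last exact: graph_equiv_trans.
by apply: graph_equiv_trans; exact: graph_equiv_sym.
Qed.

End UnitInterval.

(** * Functions with a given word *)

Definition word_at (R : realType) (w : seq R * seq R) (i : nat) : R :=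
  if odd i then nth 0 w.2 i./2 else nth 0 w.1 i./2.

Lemma word_at_double (R : realType) (w : seq R * seq R) i : word_at w i.*2 = nth 0 w.1 i.
Proof. by rewrite /word_at odd_double doubleK. Qed.

Lemma word_at_doubleS (R : realType) (w : seq R * seq R) i : word_at w i.*2.+1 = nth 0 w.2 i.
Proof. by rewrite /word_at /= odd_double uphalf_double. Qed.

Section Profile.
Variable R : realType.
Implicit Types (f g : I01 R -> R) (n : nat) (w : seq R * seq R) (k : nat -> I01 R).
Implicit Types p x y z : I01 R.

(** Strict monotonicity between the knots replaces linearity: it survives reparametrization, and
    with the values at the knots it determines a continuous f up to graph-equivalence. *)
Record profile f n w k := Profile {
  profile_size1 : size w.1 = n.+1;
  profile_size2 : size w.2 = n;
  profile_first : k 0%N = I0 R;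
  profile_last : k n.*2 = I1 R;
  profile_incr : forall i, (i < n.*2)%N -> set_val (k i) < set_val (k i.+1);
  profile_val : forall i, (i <= n.*2)%N -> f (k i) = word_at w i;
  profile_mono : forall i x y, (i < n.*2)%N -> set_val (k i) <= set_val x ->
    set_val x < set_val y -> set_val y <= set_val (k i.+1) ->
    if odd i then f y < f x else f x < f y
}.

Section Knots.
Variables (f : I01 R -> R) (n : nat) (w : seq R * seq R) (k : nat -> I01 R).
Hypothesis pf : profile f n w k.

Lemma knot_lt i j : (i < j <= n.*2)%N -> set_val (k i) < set_val (k j).
Proof.
move=> /andP[ij jn]; elim: j ij jn => // j IH ij jn.
have h := profile_incr pf jn.
have [->//|ne] := eqVneq i j; apply: lt_trans h; apply: IH; lia.
Qed.

Lemma knot_le i j : (i <= j <= n.*2)%N -> set_val (k i) <= set_val (k j).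
Proof.
move=> ij; have [->//|ne] := eqVneq i j; apply/ltW/knot_lt; lia.
Qed.

Lemma knot_inj i j : (i <= n.*2)%N -> (j <= n.*2)%N -> k i = k j -> i = j.
Proof.
move=> hi hj e; have [ij|ji|//] := ltngtP i j.
- by have := @knot_lt i j; rewrite e ltxx; lia.
- by have := @knot_lt j i; rewrite e ltxx; lia.
Qed.

Lemma knot_locate i j z : (i < j <= n.*2)%N -> set_val (k i) <= set_val z <= set_val (k j) ->
  exists2 q, (i <= q < j)%N & set_val (k q) <= set_val z <= set_val (k q.+1).
Proof.
move=> /andP[ij jn] /andP[iz zj]; elim: j ij jn zj => // j IH ij jn zj.
have [jz|/ltW zj'] := leP (set_val (k j)) (set_val z).
  by exists j; [lia|rewrite jz].
have [e|ne] := eqVneq i j; first by subst j; exists i; [lia|rewrite iz].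
have [||//|q hq hz] := IH; [lia|lia|]; exists q => //; lia.
Qed.

Lemma profile_pos : (0 < n)%N.
Proof.
case: (posnP n) (profile_last pf) => // ->; rewrite (profile_first pf) => e.
by have := congr1 set_val e => /= /eqP; rewrite eq_sym oner_eq0.
Qed.

Lemma profile_locate z :
  exists2 q, (q < n.*2)%N & set_val (k q) <= set_val z <= set_val (k q.+1).
Proof.
have n0 := profile_pos.
have [||q hq hz] := @knot_locate 0 n.*2 z; first lia.
  by rewrite (profile_first pf) (profile_last pf) I01_bounds.
by exists q => //; lia.
Qed.

Lemma profile_mono_le i x y : (i < n.*2)%N -> set_val (k i) <= set_val x ->
  set_val x <= set_val y -> set_val y <= set_val (k i.+1) ->
  if odd i then f y <= f x else f x <= f y.
Proof.
move=> hi ix; rewrite le_eqVlt => /orP[/eqP/I01_inj ->|xy] yi.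
  by rewrite lexx if_same.
by have := profile_mono pf hi ix xy yi; case: ifP => _ /ltW.
Qed.

Lemma profile_inj i x y : (i < n.*2)%N -> set_val (k i) <= set_val x <= set_val (k i.+1) ->
  set_val (k i) <= set_val y <= set_val (k i.+1) -> f x = f y -> x = y.
Proof.
move=> hi /andP[ix xi] /andP[iy yi] e; apply: I01_inj.
have [xy|yx|//] := ltgtP (set_val x) (set_val y).
- by have := profile_mono pf hi ix xy yi; rewrite e ltxx if_same.
- by have := profile_mono pf hi iy yx xi; rewrite e ltxx if_same.
Qed.

Lemma profile_piece i x : (i < n.*2)%N -> set_val (k i) <= set_val x <= set_val (k i.+1) ->
  if odd i then word_at w i.+1 <= f x <= word_at w i else word_at w i <= f x <= word_at w i.+1.
Proof.
move=> hi /andP[ix xi]; rewrite -!(profile_val pf) ?(ltnW hi) //.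
have := profile_mono_le hi (lexx _) ix xi; have := profile_mono_le hi ix xi (lexx _).
by case: ifP => _ -> ->.
Qed.

Lemma profile_zigzag : zigzag n w.
Proof.
move=> l ln; have i1 : (l.*2 < n.*2)%N by lia.
have i2 : (l.*2.+1 < n.*2)%N by lia.
have := profile_mono pf i1 (lexx _) (profile_incr pf i1) (lexx _).
have := profile_mono pf i2 (lexx _) (profile_incr pf i2) (lexx _).
rewrite !(profile_val pf) ?(ltnW i1) // -doubleS word_at_double word_at_doubleS.
by rewrite word_at_double /= odd_double.
Qed.

Lemma knot_near i : (i <= n.*2)%N -> exists2 e, 0 < e & forall x,
  `|set_val x - set_val (k i)| < e ->
  ((0 < i)%N -> set_val (k i.-1) < set_val x) /\
  ((i < n.*2)%N -> set_val x < set_val (k i.+1)).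
Proof.
move=> hi.
have [e1 e10 h1] : exists2 e, 0 < e & forall x, `|set_val x - set_val (k i)| < e ->
    (0 < i)%N -> set_val (k i.-1) < set_val x.
  case: (posnP i) => [->|i0]; first by exists 1.
  have lt : set_val (k i.-1) < set_val (k i) by apply: knot_lt; lia.
  exists (set_val (k i) - set_val (k i.-1)); first by rewrite subr_gt0.
  by move=> x; rewrite ltr_distl => /andP[h _] _; lra.
have [e2 e20 h2] : exists2 e, 0 < e & forall x, `|set_val x - set_val (k i)| < e ->
    (i < n.*2)%N -> set_val x < set_val (k i.+1).
  have [ni|ni] := leqP n.*2 i; first by exists 1.
  have lt := profile_incr pf ni.
  exists (set_val (k i.+1) - set_val (k i)); first by rewrite subr_gt0.
  by move=> x; rewrite ltr_distl => /andP[_ h] _; lra.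
exists (Order.min e1 e2); first by rewrite lt_min e10.
by move=> x; rewrite lt_min => /andP[/h1 ? /h2 ?].
Qed.

Lemma local_knot i : (i <= n.*2)%N ->
  if odd i then local_max f (k i) else local_min f (k i).
Proof.
move=> hi; have [e e0 h] := knot_near hi.
have left x : `|set_val x - set_val (k i)| < e -> set_val x <= set_val (k i) ->
    if odd i then f x <= f (k i) else f (k i) <= f x.
  move=> /h[hx _]; case: (posnP i) => i0 xi.
    have -> : x = k i; last by rewrite lexx if_same.
    apply/I01_inj/le_anti; rewrite xi i0 (profile_first pf) /=.
    by have /andP[] := I01_bounds x.
  have hi' : (i.-1 < n.*2)%N by lia.
  have := profile_mono_le hi' (ltW (hx i0)) xi; rewrite prednK // => /(_ (lexx _)).
  have -> : odd i = ~~ odd i.-1 by rewrite -{1}(prednK i0).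
  by case: (odd i.-1).
have right x : `|set_val x - set_val (k i)| < e -> set_val (k i) <= set_val x ->
    if odd i then f x <= f (k i) else f (k i) <= f x.
  move=> /h[_ hx]; have [ni|ni] := leqP n.*2 i => ix.
    have iE : i = n.*2 by lia.
    have -> : x = k i; last by rewrite lexx if_same.
    apply/I01_inj/le_anti; rewrite ix iE (profile_last pf) andbT.
    by have /andP[] := I01_bounds x.
  exact: profile_mono_le ni (lexx _) ix (ltW (hx ni)).
have loc x : `|set_val x - set_val (k i)| < e ->
    if odd i then f x <= f (k i) else f (k i) <= f x.
  by move=> hx; have [xi|/ltW ix] := leP (set_val x) (set_val (k i)); [apply: left|apply: right].
by case: (odd i) loc => loc; apply/near_I01; exists e.
Qed.

Lemma approach_left (a : R) p e : 0 <= a -> a < set_val p -> 0 < e ->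
  exists x, [/\ a <= set_val x, set_val x < set_val p & `|set_val x - set_val p| < e].
Proof.
move=> a0 ap e0; have /andP[p0 p1] := I01_bounds p.
set r := Order.max a (set_val p - e / 2).
have ar : a <= r by rewrite le_max lexx.
have re : set_val p - e / 2 <= r by rewrite le_max lexx orbT.
have rp : r < set_val p by rewrite gt_max ap; lra.
exists (clamp r); rewrite val_clamp; last by lra.
by split => //; rewrite ltr_distl; lra.
Qed.

Lemma approach_right (a : R) p e : a <= 1 -> set_val p < a -> 0 < e ->
  exists x, [/\ set_val p < set_val x, set_val x <= a & `|set_val x - set_val p| < e].
Proof.
move=> a1 pa e0; have /andP[p0 p1] := I01_bounds p.
set r := Order.min a (set_val p + e / 2).
have ar : r <= a by rewrite ge_min lexx.
have re : r <= set_val p + e / 2 by rewrite ge_min lexx orbT.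
have rp : set_val p < r by rewrite lt_min pa; lra.
exists (clamp r); rewrite val_clamp; last by lra.
by split => //; rewrite ltr_distl; lra.
Qed.

(** Inside a strictly monotone piece there are lower and higher values on the two sides of a point,
    arbitrarily near. So the knots depend on f alone. *)
Lemma profile_critical p : critical f p <-> exists2 i, (i <= n.*2)%N & p = k i.
Proof.
split=> [crit|[i hi ->]]; last first.
  by have := local_knot hi; case: (odd i) => ?; [right|left].
have [i hi /andP[ip pi]] := profile_locate p.
have [->|npi] := eqVneq p (k i); first by exists i => //; lia.
have [->|npi'] := eqVneq p (k i.+1); first by exists i.+1.
have ip' : set_val (k i) < set_val p.
  by rewrite lt_neqAle ip andbT; apply: contraNneq npi => /I01_inj ->.
have pi' : set_val p < set_val (k i.+1).
  by rewrite lt_neqAle pi andbT; apply: contraNneq npi' => /I01_inj ->.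
have /andP[a0 _] := I01_bounds (k i); have /andP[_ a1] := I01_bounds (k i.+1).
exfalso; case: crit => /near_I01[e e0 h].
- have [x [ix xp hx]] := approach_left a0 ip' e0.
  have [y [py yi hy]] := approach_right a1 pi' e0.
  have := profile_mono pf hi ix xp pi; have := profile_mono pf hi ip py yi.
  by case: ifP => _; rewrite !ltNge ?h.
- have [x [ix xp hx]] := approach_left a0 ip' e0.
  have [y [py yi hy]] := approach_right a1 pi' e0.
  have := profile_mono pf hi ix xp pi; have := profile_mono pf hi ip py yi.
  by case: ifP => _; rewrite !ltNge ?h.
Qed.

End Knots.

(** The word lists the values of f at its critical points from left to right, and an increasing list
    is determined by its members. *)
Lemma profile_uniq f n w k n' w' k' :
  profile f n w k -> profile f n' w' k' -> n = n' /\ w = w'.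
Proof.
move=> pf pf'.
pose vals m (c : nat -> I01 R) := [seq set_val (c i) | i <- iota 0 m.*2.+1].
have srt m v c : profile f m v c -> sorted <%R (vals m c).
  move=> p; apply: (path.homo_sorted_in (e:=ltn) (P:=[pred i | (i <= m.*2)%N])).
  - by move=> i j; rewrite !inE => hi hj ij; apply: (knot_lt p); lia.
  - by apply/allP => i; rewrite mem_iota inE; lia.
  - exact: iota_ltn_sorted.
have mem m v c : profile f m v c -> forall r, r \in vals m c <->
    exists2 p, critical f p & r = set_val p.
  move=> p r; split.
    move=> /mapP[i]; rewrite mem_iota => hi ->; exists (c i) => //.
    by apply/(profile_critical p); exists i => //; lia.
  by case=> q /(profile_critical p)[i hi ->] ->; apply/mapP; exists i => //; rewrite mem_iota.
have e : vals n k = vals n' k'.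
  apply: (irr_sorted_eq lt_trans) (srt _ _ _ pf) (srt _ _ _ pf') _.
    by move=> x; rewrite /= ltxx.
  move=> r; apply/idP/idP => h.
    by apply/(mem _ _ _ pf'); apply/(mem _ _ _ pf).
  by apply/(mem _ _ _ pf); apply/(mem _ _ _ pf').
have en : n = n' by have := congr1 size e; rewrite !size_map !size_iota; lia.
subst n'; split => //.
have ek i : (i <= n.*2)%N -> k i = k' i.
  move=> hi; apply: I01_inj; have := congr1 (fun s => nth 0 s i) e.
  by rewrite !(nth_map 0%N) ?size_iota // !nth_iota //; apply; lia.
have ew i : (i <= n.*2)%N -> word_at w i = word_at w' i.
  by move=> hi; rewrite -(profile_val pf) // -(profile_val pf') // ek.
rewrite [w]surjective_pairing [w']surjective_pairing; congr pair.
  apply: (@eq_from_nth _ 0); rewrite (profile_size1 pf) ?(profile_size1 pf') // => i hi.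
  by rewrite -!word_at_double ew //; lia.
apply: (@eq_from_nth _ 0); rewrite (profile_size2 pf) ?(profile_size2 pf') // => i hi.
by rewrite -!word_at_doubleS ew //; lia.
Qed.

Lemma homeo_bounds (psi : I01 R -> I01 R) : increasing_homeo psi ->
  psi (I0 R) = I0 R /\ psi (I1 R) = I1 R.
Proof.
case=> phi [_ _ K K' inc].
have le x y : set_val x <= set_val y -> set_val (psi x) <= set_val (psi y).
  by rewrite le_eqVlt => /orP[/eqP/I01_inj ->//|/inc/ltW].
split; apply/I01_inj/le_anti.
  have /andP[-> _] := I01_bounds (psi (I0 R)); rewrite andbT -{2}(K' (I0 R)).
  by apply: le => /=; have /andP[] := I01_bounds (phi (I0 R)).
have /andP[_ ->] := I01_bounds (psi (I1 R)); rewrite /= -{1}(K' (I1 R)).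
by apply: le => /=; have /andP[] := I01_bounds (phi (I1 R)).
Qed.

Lemma profile_comp f n w k (phi psi : I01 R -> I01 R) :
  profile f n w k -> increasing_homeo psi -> cancel phi psi -> cancel psi phi ->
  profile (f \o phi) n w (psi \o k).
Proof.
move=> pf hpsi K K'; have [p0 p1] := homeo_bounds hpsi.
have [phi' [_ _ K2 _ inc]] := hpsi.
have inc' x y : set_val x < set_val y -> set_val (phi x) < set_val (phi y).
  move=> xy; rewrite ltNge le_eqVlt; apply/negP => /orP[/eqP/I01_inj E|/inc].
    by rewrite -(K x) -E K ltxx in xy.
  by rewrite !K ltNge (ltW xy).
have le' x y : set_val x <= set_val y -> set_val (phi x) <= set_val (phi y).
  by rewrite le_eqVlt => /orP[/eqP/I01_inj ->//|/inc'/ltW].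
split.
- exact: profile_size1 pf.
- exact: profile_size2 pf.
- by rewrite /= (profile_first pf).
- by rewrite /= (profile_last pf).
- by move=> i hi; apply/inc/(profile_incr pf).
- by move=> i hi; rewrite /= K' (profile_val pf).
- move=> i x y hi ix xy yi; apply: (profile_mono pf) => //.
  + by rewrite -[k i]K'; apply: le'.
  + exact: inc'.
  + by rewrite -[k i.+1]K'; apply: le'.
Qed.

(* The graph of the homeomorphism between two functions with the same word. *)
Definition matched n f k f' k' x y := exists i, [/\ (i < n.*2)%N,
  set_val (k i) <= set_val x <= set_val (k i.+1),
  set_val (k' i) <= set_val y <= set_val (k' i.+1) & f x = f' y].

Lemma matched_sym n f k f' k' x y : matched n f k f' k' x y -> matched n f' k' f k y x.
Proof. by case=> i [hi hx hy e]; exists i. Qed.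

Lemma matched_total n w f k f' k' x : continuous f' ->
  profile f n w k -> profile f' n w k' -> exists y, matched n f k f' k' x y.
Proof.
move=> cf' pf pf'; have [i hi hx] := profile_locate pf x.
have [|y hy e] := IVT_I01 (v:=f x) cf' (ltW (profile_incr pf' hi)); last by exists y, i.
have := profile_piece pf hi hx; rewrite !(profile_val pf') ?(ltnW hi) //.
by rewrite ge_min le_max; case: ifP => _ /andP[-> ->]; rewrite ?orbT.
Qed.

(** For points in different pieces only a coincidence of y and y' at a common knot could break
    strictness; injectivity on the pieces then puts x and x' at that same knot too. *)
Lemma matched_lt n w f k f' k' x y x' y' :
  profile f n w k -> profile f' n w k' -> matched n f k f' k' x y ->
  matched n f k f' k' x' y' -> set_val x < set_val x' -> set_val y < set_val y'.
Proof.
move=> pf pf' [i [hi /andP[ix xi] /andP[iy yi] e]] [j [hj /andP[jx xj] /andP[jy yj] e']] xx'.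
have [ij|ji|ij] := ltngtP i j.
- have h : set_val (k' i.+1) <= set_val (k' j) by apply: (knot_le pf'); lia.
  have := le_trans yi (le_trans h jy); rewrite le_eqVlt => /orP[/eqP E|//].
  have y1 : set_val y = set_val (k' i.+1) by apply/le_anti; rewrite yi E (le_trans h).
  have y2 : set_val y' = set_val (k' j).
    by apply/le_anti; rewrite jy andbT -E (le_trans yi).
  have x1 : x = k i.+1.
    apply: (profile_inj pf hi); rewrite ?ix ?xi ?lexx ?(ltW (profile_incr pf hi)) //.
    by rewrite e (I01_inj y1) (profile_val pf) // (profile_val pf').
  have x2 : x' = k j.
    apply: (profile_inj pf hj); rewrite ?jx ?xj ?lexx ?(ltW (profile_incr pf hj)) //.
    by rewrite e' (I01_inj y2) (profile_val pf) ?(profile_val pf') // ltnW.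
  have := xx'; rewrite x1 x2 => h1.
  have : set_val (k' i.+1) < set_val (k' j).
    apply: (knot_lt pf'); rewrite (ltnW hj) andbT ltn_neqAle ij andbT.
    by apply: contraTneq h1 => ->; rewrite ltxx.
  by rewrite y1 y2.
- have h : set_val (k j.+1) <= set_val (k i) by apply: (knot_le pf); lia.
  by have := lt_le_trans xx' (le_trans xj (le_trans h ix)); rewrite ltxx.
- subst j; have := profile_mono pf hi ix xx' xj; rewrite e e' => h.
  rewrite ltNge; apply/negP => yy'.
  have := profile_mono_le pf' hi jy yy' yi.
  by case: (odd i) h => h; rewrite leNgt h.
Qed.

(** The relation [matched] is total in both directions and strictly increasing, so it is the graph
    of an increasing bijection, and such a bijection is a homeomorphism. *)
Lemma profile_graph_equiv f f' n w k k' : continuous f -> continuous f' ->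
  profile f n w k -> profile f' n w k' -> graph_equiv f f'.
Proof.
move=> cf cf' pf pf'.
have [phi hphi] := choice (fun x => matched_total x cf' pf pf').
have [psi hpsi] := choice (fun x => matched_total x cf pf' pf).
have lt x y : set_val x < set_val y -> set_val (phi x) < set_val (phi y).
  exact: (matched_lt pf pf' (hphi x) (hphi y)).
have uniq g h c c' x x' y : profile g n w c -> profile h n w c' ->
    matched n g c h c' x y -> matched n g c h c' x' y -> x = x'.
  move=> p p' m m'; apply: I01_inj; have [xx|xx|//] := ltgtP (set_val x) (set_val x').
  - by have := matched_lt p p' m m' xx; rewrite ltxx.
  - by have := matched_lt p p' m' m xx; rewrite ltxx.
exists phi.
  apply: (increasing_homeoP (psi:=psi)) => // x.
  - apply: (uniq _ _ _ _ _ _ _ pf pf' _ (hphi x)).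
    exact/matched_sym.
  - apply: (uniq _ _ _ _ _ _ _ pf' pf _ (hpsi x)).
    exact/matched_sym.
by apply: funext => x; have [i [_ _ _ ->]] := hphi x.
Qed.

End Profile.

(** * Components of the sublevel sets of a function with a given word *)

Section PresentProfile.
Variables (R : realType) (b d : nat -> R) (n : nat) (rep : R -> nat -> nat).
Variables (w : seq R * seq R) (f : I01 R -> R) (k : nat -> I01 R).
Hypotheses (ok : bars_ok b d n) (hw : w \in words b d n) (ec : elder_conn b d n w rep).
Hypothesis pf : profile f n w k.

Definition min_knot (j : nat) : I01 R := k (index (b j) w.1).*2.

Lemma below_between_sym t x y : below_between f t x y -> below_between f t y x.
Proof. by move=> h z hz; apply: h; rewrite orbC. Qed.

Lemma below_between_trans t x y z : below_between f t x y -> below_between f t y z ->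
  below_between f t x z.
Proof.
move=> h h' u hu.
have [uy|yu] := leP (set_val u) (set_val y).
  have [xz|zx] := leP (set_val x) (set_val z).
    by apply: h; case/orP: hu => /andP[h1 h2]; apply/orP; first [left; lra|right; lra].
  by apply: h'; case/orP: hu => /andP[h1 h2]; apply/orP; first [left; lra|right; lra].
have [xz|zx] := leP (set_val x) (set_val z).
  by apply: h'; case/orP: hu => /andP[h1 h2]; apply/orP; first [left; lra|right; lra].
by apply: h; case/orP: hu => /andP[h1 h2]; apply/orP; first [left; lra|right; lra].
Qed.

Lemma below_between_refl t x : f x <= t -> below_between f t x x.
Proof.
move=> hx z; rewrite orbb => /le_anti/I01_inj <- //.
Qed.

Lemma component_eq t x y : f x <= t -> f y <= t ->
  path_component R (sublevel f t) x = path_component R (sublevel f t) y <->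
  below_between f t x y.
Proof.
move=> hx hy; split=> [e|h].
  apply/path_in_sublevel; change (path_component R (sublevel f t) x y).
  by rewrite e; apply/path_in_sublevel/below_between_refl.
apply/seteqP; split => z /path_in_sublevel hz; apply/path_in_sublevel.
  exact: below_between_trans (below_between_sym h) hz.
exact: below_between_trans h hz.
Qed.

Lemma min_knot_val j : (j <= n)%N -> f (min_knot j) = b j.
Proof.
move=> hj; have := index_birth_words hw hj => hi.
by rewrite (profile_val pf) ?leq_double // word_at_double nth_index // (birth_mem_words hw).
Qed.

(** On each monotone piece f is bounded by the maximum at one of its ends, so only the maxima in
    between matter. *)
Lemma below_between_knots t i j : (i <= n)%N -> (j <= n)%N ->
  f (k i.*2) <= t -> f (k j.*2) <= t ->
  below_between f t (k i.*2) (k j.*2) <-> connected_at t w.2 i j.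
Proof.
wlog ij : i j / (i <= j)%N.
  move=> H hi hj fi fj; have [ij|/ltnW ji] := leqP i j; first exact: H.
  have := H j i ji hj hi fj fi => -[H1 H2]; split.
    by move/below_between_sym/H1/connected_at_sym.
  by move/connected_at_sym/H2/below_between_sym.
move=> hi hj fi fj; split=> [h l hl|h z hz].
  have hl' : (i <= l < j)%N by lia.
  rewrite -word_at_doubleS -(profile_val pf); last lia.
  by apply: h; apply/orP; left; apply/andP; split; apply: (knot_le pf); lia.
have [e|ne] := eqVneq i j.
  by subst j; rewrite orbb in hz; move/le_anti/I01_inj: hz => <-.
have lt : set_val (k i.*2) < set_val (k j.*2) by apply: (knot_lt pf); lia.
have hz' : set_val (k i.*2) <= set_val z <= set_val (k j.*2).
  by case/orP: hz => // hz; lra.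
have [|q hq hz2] := knot_locate (n:=n) _ hz'; first by lia.
have hqn : (q < n.*2)%N by move: hq hj; clear; lia.
have := profile_piece pf hqn hz2.
have qE := odd_double_half q; case: (odd q) qE => qE /andP[_] /le_trans; apply.
  by rewrite -qE add1n word_at_doubleS; apply: h; move: hq qE; clear; lia.
by rewrite -qE add0n word_at_doubleS; apply: h; move: hq qE; clear; lia.
Qed.

(** Sliding down the piece of x leads to a minimum without rising above [f x]: to the right end of
    an odd piece, to the left end of an even one. *)
Lemma below_between_min t x : f x <= t ->
  exists j, [/\ (j <= n)%N, b j <= t & below_between f t (min_knot j) x].
Proof.
move=> hx; have [q hq hz] := profile_locate pf x.
suff [i [hi h]] : exists i, (i <= n)%N /\ below_between f t (k i.*2) x.
  have [j hj jE] := nth_words1 hw hi.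
  have iE : index (b j) w.1 = i.
    rewrite -jE index_uniq ?(size_words1 hw) //.
    by have := uniq_words ok hw; rewrite cat_uniq => /and3P[].
  exists j; split => //; last by rewrite /min_knot iE.
  rewrite -jE -word_at_double -(profile_val pf) ?leq_double //.
  by apply: h; apply/orP; have [xk|kx] := leP (set_val (k i.*2)) (set_val x); [left|right]; rewrite lexx ?xk ?(ltW kx).
have qE := odd_double_half q; case E: (odd q) qE => qE.
  exists q./2.+1; split; first by lia.
  have -> : (q./2.+1).*2 = q.+1 by lia.
  case/andP: hz => qx xq z /orP[/andP[qz zx]|/andP[xz zq]].
    have -> // : z = x by apply/I01_inj/le_anti; rewrite zx (le_trans xq).
  by have := profile_mono_le pf hq qx xz zq; rewrite E => /le_trans; apply.
exists q./2; split; first by lia.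
have -> : (q./2).*2 = q by lia.
case/andP: hz => qx xq z /orP[/andP[qz zx]|/andP[xz zq]].
  by have := profile_mono_le pf hq qz zx xq; rewrite E => /le_trans; apply.
have -> // : z = x by apply/I01_inj/le_anti; rewrite xz (le_trans zq).
Qed.

Lemma presented_profile : presented b n rep (pi0_sublevel f)
  (fun t j => path_component R (sublevel f t) (min_knot j)).
Proof.
split.
- move=> t C; split=> [[x hx <-]|[j [hj bj ->]]].
    have [j [hj bj h]] := below_between_min hx; exists j; split => //.
    apply/component_eq; rewrite ?min_knot_val //; exact: below_between_sym.
  by exists (min_knot j) => //; rewrite /sublevel /= min_knot_val.
- move=> t i j hi hj bi bj; rewrite component_eq ?min_knot_val //.
  rewrite below_between_knots -/(min_knot _) ?min_knot_val ?(index_birth_words hw) //.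
  by have [_ h] := ec; apply: h.
- move=> r t j hj br rt; have bt := le_trans br rt.
  apply/seteqP; split => [z [x /path_in_sublevel hx hz]|z hz]; last first.
    exists (min_knot j) => //; apply/path_in_sublevel/below_between_refl.
    by rewrite min_knot_val.
  have h : below_between f t (min_knot j) x.
    by move=> u /hx hu; apply: le_trans rt.
  move/path_in_sublevel: hz => hz; apply/path_in_sublevel.
  exact: below_between_trans h hz.
Qed.

End PresentProfile.

(** * Sublevel sets of a merge tree *)

Lemma continuous_to_set_type (R : realType) (A : set R) (T : topologicalType)
  (g : T -> set_type A) : continuous (set_val \o g : T -> R) -> continuous g.
Proof.
move=> cg t V [V0 [[W oW <-] /= Wg sub]].
have nW : nbhs (set_val (g t)) W by apply: open_nbhs_nbhs.
have nW' : nbhs t (fun s => W (set_val (g s))) := cg t W nW.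
change (nbhs t (fun s => V (g s))).
by apply: filterS nW' => s; exact: sub.
Qed.

Section Paths.
Variables (R : realType) (X : topologicalType).
Implicit Types (A : set X) (x y z : X).

Lemma path_in_end A x y : Defs.path_in R A x y -> A y.
Proof. by case=> g [_ _ <- sub]; apply: sub; exists (I1 R). Qed.

(** Paths defined on the whole line can be reversed and concatenated by formulas with [clamp]. *)
Lemma path_in_line A x y (g : R -> X) : continuous g -> g 0 = x -> g 1 = y ->
  (forall r, 0 <= r <= 1 -> A (g r)) -> Defs.path_in R A x y.
Proof.
move=> cg g0 g1 gA; exists (g \o set_val); split => //.
- move=> s; apply: continuous_comp; [exact: continuous_set_val|exact: cg].
- by move=> _ [s _ <-]; apply/gA/I01_bounds.
Qed.

Lemma path_in_sym A x y : Defs.path_in R A x y -> Defs.path_in R A y x.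
Proof.
case=> g [cg g0 g1 gA]; apply: (@path_in_line _ _ _ (fun r => g (clamp (1 - r)))).
- have cf : continuous (fun r : R => 1 - r).
    by move=> r; apply: cvgB; [exact: cvg_cst|exact: cvg_id].
  by move=> r V hV; exact: cf _ _ (continuous_clamp (cg _ _ hV)).
- by rewrite subr0 -[1]/(set_val (I1 R)) clampK.
- by rewrite subrr -[0]/(set_val (I0 R)) clampK.
- by move=> r _; apply: gA; exists (clamp (1 - r)).
Qed.

Lemma path_in_trans A x y z :
  Defs.path_in R A x y -> Defs.path_in R A y z -> Defs.path_in R A x z.
Proof.
case=> g [cg g0 g1 gA] [h [ch h0 h1 hA]].
pose G r := g (clamp (r * 2)); pose H r := h (clamp (r * 2 - 1)).
have cG : continuous G.
  have cf : continuous (fun r : R => r * 2).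
    by move=> r; apply: cvgM; [exact: cvg_id|exact: cvg_cst].
  by move=> r V hV; exact: cf _ _ (continuous_clamp (cg _ _ hV)).
have cH : continuous H.
  have cf : continuous (fun r : R => r * 2 - 1).
    move=> r; apply: cvgB; last exact: cvg_cst.
    by apply: cvgM; [exact: cvg_id|exact: cvg_cst].
  by move=> r V hV; exact: cf _ _ (continuous_clamp (ch _ _ hV)).
have GH : G (1 / 2) = H (1 / 2).
  rewrite /G /H divrK ?unitfE // subrr -{1}[1]/(set_val (I1 R)) -[0]/(set_val (I0 R)).
  by rewrite !clampK g1 h0.
apply: (@path_in_line _ _ _ (fun r => if r <= 1 / 2 then G r else H r)).
- move=> r V hV; change (nbhs r (fun s => V (if s <= 1 / 2 then G s else H s))).
  have [lt|gt|e] := ltgtP r (1 / 2).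
  + rewrite (ltW lt) in hV; have hG : nbhs r (fun s => V (G s)) := cG r V hV.
    apply: filterS2 hG (lt_nbhsl lt) => s Gs hs.
    by rewrite (ltW hs).
  + rewrite leNgt gt in hV; have hH : nbhs r (fun s => V (H s)) := cH r V hV.
    apply: filterS2 hH (lt_nbhsr gt) => s Hs hs.
    by rewrite leNgt hs.
  + rewrite e lexx in hV *; have hG : nbhs (1 / 2 : R) (fun s => V (G s)) := cG _ V hV.
    rewrite GH in hV; have hH : nbhs (1 / 2 : R) (fun s => V (H s)) := cH _ V hV.
    by apply: filterS2 hG hH => s Gs Hs; case: ifP.
- by rewrite ifT ?divr_ge0 // /G mul0r -[0]/(set_val (I0 R)) clampK.
- rewrite ifF; last by apply/negbTE; rewrite -ltNge; lra.
  have E : (1 : R) * 2 - 1 = 1 by lra.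
  by rewrite /H E -[X in clamp X]/(set_val (I1 R)) clampK.
- by move=> r _; case: ifP => _; [apply: gA|apply: hA]; [exists (clamp (r * 2))|exists (clamp (r * 2 - 1))].
Qed.

(** T has no topology: the open sets [O Q], which on A are the preimages of Q under F, express that
    F is locally constant along A. The indicator of a value of F along the path is then continuous,
    and by the intermediate value theorem it cannot take both values 0 and 1. *)
Lemma path_locally_constant A (T : Type) (F : X -> T) (O : (T -> Prop) -> set X) x y :
  (forall Q, open (O Q)) -> (forall Q p, O Q p -> Q (F p)) ->
  (forall (Q : T -> Prop) p, A p -> Q (F p) -> O Q p) ->
  Defs.path_in R A x y -> F x = F y.
Proof.
move=> oO OF FO [g [cg g0 g1 gA]].
pose e (s : I01 R) : R := if `[< F (g s) = F x >] then 0 else 1.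
have ce : continuous e.
  apply/continuous_I01P => s r r0.
  have cst Q : Q (F (g s)) -> exists2 v, 0 < v &
      forall u, `|set_val u - set_val s| < v -> Q (F (g u)).
    move=> hQ; have oQ : nbhs (g s) (O Q).
      by apply: open_nbhs_nbhs; split; [exact: oO|apply: FO => //; apply: gA; exists s].
    by have /near_I01[v v0 hv] := cg s _ oQ; exists v => // u /hv; apply: OF.
  have [h|h] := pselect (F (g s) = F x).
    have [v v0 hv] := cst (fun z : T => z = F x) h.
    by exists v => // u /hv hu; rewrite /e !asboolT // subrr normr0.
  have [v v0 hv] := cst (fun z : T => z <> F x) h.
  by exists v => // u /hv hu; rewrite /e !asboolF // subrr normr0.
apply: contrapT => ne.
have e0 : e (I0 R) = 0 by rewrite /e asboolT // g0.
have e1 : e (I1 R) = 1 by rewrite /e asboolF // g1; exact: nesym.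
have [||s _] := @IVT_I01 R e (I0 R) (I1 R) (1 / 2) ce.
- by rewrite /= ler01.
- by rewrite e0 e1 ge_min le_max; lra.
- by rewrite /e; case: ifP => _; lra.
Qed.

End Paths.

(** * Path components of the sublevel sets of a merge tree, described by the stages of its Morse
    set *)

Section MergeTree.
Local Open Scope quotient_scope.
Variables (R : realType) (U : choiceType) (S : morse_set R U).

Let T i : R := nth 0 (ms_times S) i.
Let n := size (ms_times S).
Let F : functorial S. Proof. by have [] := ms_axioms S. Qed.
Let mt : morse_times S (ms_times S). Proof. by have [] := ms_axioms S. Qed.

Lemma times_pos : (0 < n)%N.
Proof. by have [] := mt. Qed.

Lemma times_le i j : (i <= j < n)%N -> T i <= T j.
Proof.
case/andP=> ij jn; have [_ [srt _]] := mt.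
rewrite /T (lt_sorted_leq_nth 0 (s:=ms_times S)) ?inE //.
exact: leq_ltn_trans jn.
Qed.

Lemma times_leS i : (i.+1 < n)%N -> T i <= T i.+1.
Proof. by move=> h; apply: times_le; rewrite leqnSn. Qed.

Lemma cell_index_lt (a : cells S) : (cell_index a < n)%N.
Proof. by have [] := set_valP (projT1 a). Qed.

Lemma cell_stage (a : cells S) : stage S (T (cell_index a)) (cell_elt a).
Proof. by have [] := set_valP (projT1 a). Qed.

Lemma cell_heightP (a : cells S) : cell_itv S (cell_index a) (cell_height a).
Proof. exact: set_valP. Qed.

Lemma cell_height_ge (a : cells S) : T (cell_index a) <= cell_height a.
Proof.
have := cell_heightP a.
by rewrite /cell_itv; case: ifP => _; rewrite /= in_itv /= => /andP[].
Qed.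

Lemma cell_exists i x r : (i < n)%N -> stage S (T i) x -> T i <= r ->
  ((i.+1 < n)%N -> r <= T i.+1) ->
  exists a : cells S, [/\ cell_index a = i, cell_elt a = x & cell_height a = r].
Proof.
move=> hi hx ir ri.
have hc : (i, x) \in [set c : nat * U | (c.1 < n)%N /\ stage S (T c.1) c.2] by rewrite inE.
pose c : cell S := SigSub hc.
have hr : r \in cell_itv S (set_val c).1.
  rewrite inE /cell_itv /= -/n; case: ifP => h; rewrite /= in_itv /= ir //.
  exact: ri.
by exists (existT _ c (SigSub hr : cell_space c)).
Qed.

Definition level (t : R) (a : cells S) : U := Defs.shift S (T (cell_index a)) t (cell_elt a).

(** A point at the top of a cell is also the bottom of the next one, whose level at t makes sense
    only if that cell starts by time t. The condition on t ensures this and, unlike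
    [cell_height a <= t], still allows points somewhat above t. *)
Lemma glue_level a b : Defs.glue S a b -> cell_height a = cell_height b /\
  forall t, (forall i, (i < n)%N -> T i <= cell_height a -> T i <= t) -> level t a = level t b.
Proof.
move/asboolP; elim=> {a b} [a b [ib eb ha hb]|a|a b _ [e h]|a b c _ [e h] _ [e' h']].
- split; first by rewrite ha hb.
  move=> t ht; have := cell_index_lt b; rewrite ib => hn.
  have it : T (cell_index a).+1 <= t by apply: ht => //; rewrite ha.
  have [_ _ comp] := F.
  rewrite /level ib eb -/(T _) comp //; last exact: cell_stage.
  by apply: times_le; rewrite leqnSn.
- by [].
- by split=> // t ht; rewrite h // e.
- by split=> [|t ht]; rewrite ?e // h // h' // -e.
Qed.

Local Notation tree := (merge_tree S).
Local Notation proj := (\pi_({eq_quot (Defs.glue S)}) : cells S -> tree).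

Definition tree_level (t : R) (p : tree) : U := level t (repr (p : {eq_quot (Defs.glue S)})).

Lemma glue_repr a : Defs.glue S a (repr (proj a : {eq_quot (Defs.glue S)})).
Proof. by apply/eqquotP; symmetry; exact: reprK. Qed.

Lemma tree_height_proj a : tree_height (proj a) = cell_height a.
Proof. by have [-> _] := glue_level (glue_repr a). Qed.

Lemma tree_level_proj t a : (forall i, (i < n)%N -> T i <= cell_height a -> T i <= t) ->
  tree_level t (proj a) = level t a.
Proof. by have [_ h] := glue_level (glue_repr a) => /h. Qed.

Lemma tree_level_proj_le t a : cell_height a <= t -> tree_level t (proj a) = level t a.
Proof. by move=> ht; apply: tree_level_proj => i _ ih; exact: le_trans ht. Qed.

Lemma proj_surj p : exists a, p = proj a.
Proof. by exists (repr (p : {eq_quot (Defs.glue S)})); rewrite reprK. Qed.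

Lemma tree_level_stage t p : tree_height p <= t -> stage S t (tree_level t p).
Proof.
have [a ->] := proj_surj p; rewrite tree_height_proj => ht.
rewrite tree_level_proj_le //; have [h _ _] := F.
by apply: h; [exact: le_trans (cell_height_ge a) ht|exact: cell_stage].
Qed.

Lemma tree_level_comp r t p : tree_height p <= r -> r <= t ->
  Defs.shift S r t (tree_level r p) = tree_level t p.
Proof.
have [a ->] := proj_surj p; rewrite tree_height_proj => hr rt.
rewrite !tree_level_proj_le // ?(le_trans hr rt) //; have [_ _ h] := F.
by apply: h => //; [exact: le_trans (cell_height_ge a) hr|exact: cell_stage].
Qed.

(** Heights may exceed t, up to u, so that such sets are open around the points of height exactly
    t. *)
Definition label_set (u t : R) (Q : U -> Prop) : set tree :=
  [set p | tree_height p < u /\ Q (tree_level t p)].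

(** The level is constant on each cell, so the trace on a cell is empty or the part below u. *)
Lemma label_set_open u t Q :
  (forall i, (i < n)%N -> T i < u -> T i <= t) -> open (label_set u t Q).
Proof.
move=> ht; change (open (proj @^-1` label_set u t Q)).
apply/sigT_openP => c.
pose E := [set h : cell_space c | set_val (h : set_type _) < u].
have oE : open E.
  exists [set r | r < u]; first exact: open_lt.
  by apply/seteqP; split.
have -> : existT (@cell_space R U S) c @^-1` (proj @^-1` label_set u t Q) =
    [set h | E h /\ Q (Defs.shift S (T (set_val c).1) t (set_val c).2)].
  apply/seteqP; split => h; rewrite /label_set /preimage /= tree_height_proj.
    move=> [hu]; rewrite tree_level_proj //.
    by move=> i hi ih; apply: ht => //; exact: le_lt_trans hu.
  move=> [hu hQ]; split => //; rewrite tree_level_proj //.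
  by move=> i hi ih; apply: ht => //; exact: le_lt_trans hu.
have [hQ|hQ] := pselect (Q (Defs.shift S (T (set_val c).1) t (set_val c).2)).
  by rewrite (_ : [set h | _] = E) //; apply/seteqP; split => [h []|].
by rewrite (_ : [set h | _] = set0); [exact: open0|apply/seteqP; split => [h []|]].
Qed.

Lemma same_cell_path t a b : cell_index a = cell_index b -> cell_elt a = cell_elt b ->
  cell_height a <= t -> cell_height b <= t ->
  Defs.path_in R (sublevel (@tree_height R U S) t) (proj a) (proj b).
Proof.
case: a b => [c h] [c' h'] ei ee ha hb.
have ec : c = c'.
  apply: val_inj; change (set_val c = set_val c').
  by rewrite [LHS]surjective_pairing [RHS]surjective_pairing; congr pair.
subst c'; move: ha hb; rewrite /cell_height /=.
set x := set_val (h : set_type _); set y := set_val (h' : set_type _) => xt yt.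
pose L (s : R) := x + s * (y - x).
have Lc (s : I01 R) : L (set_val s) \in cell_itv S (set_val c).1.
  have /andP[s0 s1] := I01_bounds s.
  have : cell_itv S (set_val c).1 x by exact: set_valP.
  have : cell_itv S (set_val c).1 y by exact: set_valP.
  rewrite inE /cell_itv /L.
  by case: ifP => _; rewrite /= !in_itv /= ?andbT; [move=> /andP[? ?] /andP[? ?]; apply/andP; split|]; nra.
pose g (s : I01 R) : cells S := existT (@cell_space R U S) c (SigSub (Lc s)).
exists (proj \o g); split.
- have cL : continuous (fun s => SigSub (Lc s) : cell_space c).
    apply: continuous_to_set_type.
    have cL' : continuous L.
      move=> s; apply: cvgD; first exact: cvg_cst.
      by apply: cvgM; [exact: cvg_id|exact: cvg_cst].
    by move=> s V hV; exact: continuous_set_val (cL' _ _ hV).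
  move=> s V hV.
  have n1 : nbhs (g s) (proj @^-1` V) := @pi_continuous _ {eq_quot (Defs.glue S)} (g s) V hV.
  have n2 : nbhs (SigSub (Lc s) : cell_space c)
    (existT (@cell_space R U S) c @^-1` (proj @^-1` V)) :=
    @existT_continuous (cell S) (@cell_space R U S) c (SigSub (Lc s)) _ n1.
  exact: cL s _ n2.
- congr (proj (existT _ _ _)); apply: val_inj => /=; rewrite /L /=.
  by rewrite mul0r addr0.
- congr (proj (existT _ _ _)); apply: val_inj => /=; rewrite /L /=.
  by rewrite mul1r subrKC.
- move=> _ [s _ <-]; rewrite /sublevel /= tree_height_proj.
  change (x + set_val s * (y - x) <= t).
  by have /andP[s0 s1] := I01_bounds s; nra.
Qed.

(** Induction on the number of cells to climb: go up to the top of the cell of a, cross the gluing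
    to the bottom of the next cell, and repeat. *)
Lemma path_to_stage t i x a b : (i < n)%N -> T i <= t -> ((i.+1 < n)%N -> t < T i.+1) ->
  cell_height a <= t -> level (T i) a = x ->
  cell_index b = i -> cell_elt b = x -> cell_height b = T i ->
  Defs.path_in R (sublevel (@tree_height R U S) t) (proj a) (proj b).
Proof.
move=> hi it ti; have [m hm] := ubnP (i - cell_index a)%N.
elim: m a hm => // m IH a hm ha hx ib eb hb.
have hbt : cell_height b <= t by rewrite hb.
have ia : (cell_index a <= i)%N.
  rewrite leqNgt; apply/negP => lt.
  have := le_trans (cell_height_ge a) ha; rewrite leNgt; case/negP.
  apply: (lt_le_trans (ti _)); last by apply: times_le; rewrite lt cell_index_lt.
  exact: leq_ltn_trans (cell_index_lt a).
have [_ sid comp] := F.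
have [e|ne] := eqVneq (cell_index a) i.
  apply: same_cell_path => //; first by rewrite ib.
  by rewrite eb -hx /level -e sid //; exact: cell_stage.
have ia' : (cell_index a < i)%N by rewrite ltn_neqAle ne.
have ia1 : ((cell_index a).+1 < n)%N by apply: leq_ltn_trans hi.
have lt1 : T (cell_index a) <= T (cell_index a).+1 by apply: times_le; rewrite leqnSn.
have [a0 [i0 e0 h0]] := cell_exists (cell_index_lt a) (cell_stage a) lt1 (fun _ => lexx _).
have st : stage S (T (cell_index a).+1) (level (T (cell_index a).+1) a).
  by have [h _ _] := F; apply: h => //; exact: cell_stage.
have [a1 [i1 e1 h1]] := cell_exists ia1 st (lexx _) (@times_leS _).
have t1 : T (cell_index a).+1 <= t.
  by apply: le_trans it; apply: times_le; rewrite ia'.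
apply: (path_in_trans (y:=proj a0)).
  by apply: same_cell_path => //; rewrite ?h0.
have -> : proj a0 = proj a1.
  apply/eqquotP/asboolP; apply: rst_step; split.
  - by rewrite i1 i0.
  - by rewrite e1 i0 e0.
  - by rewrite h0 i0.
  - by rewrite h1 i0.
apply: IH => //; first by rewrite i1; move: hm ia'; clear; lia.
  by rewrite h1.
rewrite /level i1 e1 /level comp //; first by apply: times_le; rewrite ia'.
exact: cell_stage.
Qed.

Lemma tree_path_level t p q : tree_height p <= t -> tree_height q <= t ->
  Defs.path_in R (sublevel (@tree_height R U S) t) p q <-> tree_level t p = tree_level t q.
Proof.
move=> hp hq.
have ge0 : T 0 <= t.
  rewrite leNgt; apply/negP => t0; have [_ [_ [emp _]]] := mt.
  by have := tree_level_stage hp; rewrite emp.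
have [i [hi it ti]] := times_locate times_pos ge0.
split=> [pq|e].
  (* The next critical time bounds the strip in which the level is locally constant. On the last
     interval there is none, but the stage is a single point. *)
  have [hi'|hi'] := ltnP i.+1 n.
    apply: (path_locally_constant (O:=label_set (T i.+1) t) _ _ _ pq).
    - move=> Q; apply: label_set_open => j hj jt; apply: le_trans it.
      apply: times_le; rewrite hi andbT leqNgt; apply/negP => ij.
      by move: jt; rewrite ltNge times_le // ij.
    - by move=> Q r [].
    - by move=> Q r hr hQ; split => //; exact: le_lt_trans hr (ti hi').
  have iE : i = n.-1 by move: hi hi'; clear; lia.
  have [_ [_ [_ [_ [fin _]]]]] := mt.
  have [|x hx] := fin t; first by rewrite -/n -iE.
  have := tree_level_stage hp; have := tree_level_stage hq.
  by rewrite hx => -> ->.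
have [[a pE] [b qE]] := (proj_surj p, proj_surj q).
subst p q; rewrite !tree_height_proj in hp hq.
rewrite !tree_level_proj_le // in e.
have ge0' (c : cells S) : cell_height c <= t -> T (cell_index c) <= T i.
  move=> hc; apply: times_le; rewrite hi andbT leqNgt; apply/negP => ij.
  have := le_trans (cell_height_ge c) hc; rewrite leNgt; case/negP.
  apply: (lt_le_trans (ti _)); last by apply: times_le; rewrite ij cell_index_lt.
  exact: leq_ltn_trans (cell_index_lt c).
have [fst _ comp] := F.
have sta (c : cells S) : cell_height c <= t -> stage S (T i) (level (T i) c).
  by move=> hc; apply: fst; [exact: ge0'|exact: cell_stage].
(* The shift from [T i] to t is injective, so equal levels at t are already equal at [T i]; both
   points then climb to the bottom of one cell. *)
have e' : level (T i) a = level (T i) b.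
  have [_ inj _] := interval_bij F mt hi (lexx _) it ti.
  apply: inj; rewrite ?inE; [exact: sta|exact: sta|].
  by rewrite /level !comp //; [exact: ge0'|exact: cell_stage|exact: ge0'|exact: cell_stage].
have [c [ic ec hc]] := cell_exists hi (sta _ hp) (lexx _) (@times_leS _).
apply: (path_in_trans (y:=proj c)); first exact: path_to_stage ic ec hc.
by apply: path_in_sym; apply: path_to_stage ic ec hc => //; rewrite -e'.
Qed.

Lemma tree_component t p : tree_height p <= t ->
  path_component R (sublevel (@tree_height R U S) t) p =
  [set q | tree_height q <= t /\ tree_level t q = tree_level t p].
Proof.
move=> hp; apply/seteqP; split => q.
  by move=> pq; have hq := path_in_end pq; split => //; apply/esym/tree_path_level.
by move=> [hq /esym e]; apply/tree_path_level.
Qed.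

Lemma tree_level_surj t x : stage S t x ->
  exists p : tree, tree_height p <= t /\ tree_level t p = x.
Proof.
move=> hx.
have ge0 : T 0 <= t.
  rewrite leNgt; apply/negP => t0; have [_ [_ [emp _]]] := mt.
  by rewrite emp in hx.
have [i [hi it ti]] := times_locate times_pos ge0.
have [_ _ sur] := interval_bij F mt hi (lexx _) it ti.
have [y hy <-] := sur _ hx.
have [c [ic ec hc]] := cell_exists hi hy (lexx _) (@times_leS _).
exists (proj c); rewrite tree_height_proj hc; split => //.
by rewrite tree_level_proj_le ?hc // /level ic ec.
Qed.

(** The level identifies the components of the tree at time t with the stage of S, compatibly with
    the shifts, so the names carry over with the same [rep]. *)
Lemma presented_tree (b : nat -> R) m rep (c : R -> nat -> U) : presented b m rep S c ->
  presented b m rep (pi0_sublevel (@tree_height R U S))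
    (fun t j => [set q | tree_height q <= t /\ tree_level t q = c t j]).
Proof.
move=> pr; split.
- move=> t C; split=> [[p hp <-]|[j [hj bj ->]]].
    have /(presented_stage pr)[j [hj bj e]] := tree_level_stage hp.
    by exists j; split => //; rewrite tree_component // e.
  have [p [hp e]] := tree_level_surj (proj2 (presented_stage pr t (c t j)) (ex_intro _ j (And3 hj bj erefl))).
  by exists p => //; rewrite tree_component // e.
- move=> t k l hk hl bk bl; rewrite -(presented_eq pr) //; split=> [e|->//].
  have [p [hp ep]] := tree_level_surj (proj2 (presented_stage pr t (c t k)) (ex_intro _ k (And3 hk bk erefl))).
  have : [set q | tree_height q <= t /\ tree_level t q = c t k] p by split.
  by rewrite e => -[_]; rewrite ep.
- move=> r t k hk bk rt.
  have e p : tree_height p <= r -> tree_level r p = c r k -> tree_level t p = c t k.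
    by move=> hp ep; rewrite -(tree_level_comp hp rt) ep (presented_shift pr).
  apply/seteqP; split => [q [p [hp ep]]|q [hq eq]] /=.
    by rewrite tree_component ?(le_trans hp) // (e p).
  have [p [hp ep]] := tree_level_surj (proj2 (presented_stage pr r (c r k)) (ex_intro _ k (And3 hk bk erefl))).
  by exists p => //; rewrite tree_component ?(le_trans hp) //; split => //; rewrite (e p).
Qed.

End MergeTree.

Lemma iso_over_refl (R : realType) (X : space_over R) : iso_over X X.
Proof. by exists id, id; split => // x V. Qed.

(** * Existence of functions and words *)

Section WordAt.
Variable R : realType.
Implicit Type w : seq R * seq R.

Lemma zigzag_word_at n w i : zigzag n w -> (i < n.*2)%N ->
  if odd i then word_at w i.+1 < word_at w i else word_at w i < word_at w i.+1.
Proof.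
move=> z hi; have iE := odd_double_half i; have il : (i./2 < n)%N by lia.
have [z1 z2] := z _ il; case: (odd i) iE => /= iE.
  by rewrite -iE add1n word_at_doubleS -doubleS word_at_double.
by rewrite -iE add0n word_at_doubleS word_at_double.
Qed.

Lemma word_at_inj n w i j : size w.1 = n.+1 -> size w.2 = n -> uniq (w.1 ++ w.2) ->
  (i <= n.*2)%N -> (j <= n.*2)%N -> word_at w i = word_at w j -> i = j.
Proof.
move=> s1 s2 u hi hj.
(* The place of the i-th critical value in the list of all minima followed by all maxima. *)
pose pos i := if odd i then (n.+1 + i./2)%N else i./2.
have posE l : (l <= n.*2)%N -> word_at w l = nth 0 (w.1 ++ w.2) (pos l) /\
    (pos l < size (w.1 ++ w.2))%N.
  move=> hl; rewrite nth_cat size_cat s1 s2 /word_at /pos.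
  have lE := odd_double_half l; case: (odd l) lE => /= lE.
    by rewrite ifF; [rewrite addKn; split => //; lia|lia].
  by rewrite ifT; [split => //; lia|lia].
have [-> h1] := posE i hi; have [-> h2] := posE j hj.
move/eqP; rewrite nth_uniq // => /eqP; rewrite /pos.
have iE := odd_double_half i; have jE := odd_double_half j.
by move: iE jE; case: (odd i); case: (odd j) => /=; lia.
Qed.

End WordAt.

Section PiecewiseLinear.
Variables (R : realType) (n : nat) (w : seq R * seq R).
Hypotheses (n0 : (0 < n)%N) (s1 : size w.1 = n.+1) (s2 : size w.2 = n)
  (z : zigzag n w) (u : uniq (w.1 ++ w.2)).
Let m := n.*2.
Let M : R := m%:R.

Let M0 : 0 < M. Proof. by rewrite ltr0n /m; lia. Qed.

(** A sum of ramps over equally spaced knots. On the i-th piece the earlier ramps are saturated at 1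
    and the later ones are 0, so the sum telescopes, and continuity needs no gluing. *)
Definition pl_function (x : I01 R) : R := word_at w 0 +
  \sum_(0 <= i < m) (word_at w i.+1 - word_at w i) * set_val (clamp (M * set_val x - i%:R)).

Definition pl_knot (i : nat) : I01 R := clamp (i%:R / M).

Lemma clamp_le0 (r : R) : r <= 0 -> set_val (clamp r) = 0.
Proof.
by move=> r0; rewrite val_clampE (min_idPl _) ?(max_idPl _) // (le_trans r0).
Qed.

Lemma clamp_ge1 (r : R) : 1 <= r -> set_val (clamp r) = 1.
Proof. by move=> r1; rewrite val_clampE (min_idPr r1) (max_idPr _) // ler01. Qed.

Lemma pl_function_piece i x : (i < m)%N -> i%:R <= M * set_val x <= i.+1%:R ->
  pl_function x = word_at w i + (word_at w i.+1 - word_at w i) * (M * set_val x - i%:R).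
Proof.
move=> hi /andP[ix xi]; rewrite /pl_function (big_cat_nat (n:=i)) ?(ltnW hi) //=.
rewrite (big_ltn hi) [X in _ + (_ + (_ + X))]big1_seq => [|j]; last first.
  rewrite mem_index_iota => /and3P[_ ij _]; rewrite clamp_le0 ?mulr0 //.
  by rewrite subr_le0 (le_trans xi) // ler_nat.
rewrite addr0 val_clamp; last by rewrite subr_ge0 ix lerBlDr -natr1 addrC in xi *.
rewrite (eq_big_nat _ _ (F2 := fun j => word_at w j.+1 - word_at w j)) => [|j /andP[_ ji]].
  by rewrite telescope_sumr // addrA subrKC.
by rewrite clamp_ge1 ?mulr1 // lerBrDr nat1r (le_trans _ ix) // ler_nat ji.
Qed.

Lemma val_pl_knot i : (i <= m)%N -> set_val (pl_knot i) = i%:R / M.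
Proof.
move=> hi; apply: val_clamp; rewrite divr_ge0 ?(ltW M0) ?ler0n //=.
by rewrite ler_pdivrMr // mul1r ler_nat.
Qed.

Lemma pl_knot_le i (x : I01 R) : (i <= m)%N -> (set_val (pl_knot i) <= set_val x) = (i%:R <= M * set_val x).
Proof. by move=> hi; rewrite val_pl_knot // ler_pdivrMr // mulrC. Qed.

Lemma pl_knot_ge i (x : I01 R) : (i <= m)%N -> (set_val x <= set_val (pl_knot i)) = (M * set_val x <= i%:R).
Proof. by move=> hi; rewrite val_pl_knot // ler_pdivlMr // mulrC. Qed.

Lemma mul_pl_knot i : (i <= m)%N -> M * set_val (pl_knot i) = i%:R.
Proof. by move=> hi; rewrite val_pl_knot // mulrC divfK ?gt_eqF. Qed.

Lemma pl_function_continuous : continuous pl_function.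
Proof.
pose G (r : R) := word_at w 0 +
  \sum_(0 <= i < m) (word_at w i.+1 - word_at w i) * set_val (clamp (M * r - i%:R)).
have cG : continuous G.
  rewrite /G => r; apply: cvgD; first exact: cvg_cst.
  elim: (index_iota 0 m) => [|i s IH].
    by under eq_fun do rewrite big_nil; rewrite big_nil; exact: cvg_cst.
  under eq_fun do rewrite big_cons; rewrite big_cons; apply: cvgD => //.
  apply: cvgM; first exact: cvg_cst.
  have cl : continuous (fun r : R => M * r - i%:R).
    move=> t; apply: cvgB; last exact: cvg_cst.
    by apply: cvgM; [exact: cvg_cst|exact: cvg_id].
  by move=> V hV; exact: cl _ _ (continuous_clamp (continuous_set_val hV)).
by move=> x V hV; exact: continuous_set_val (cG _ _ hV).
Qed.

Lemma pl_function_profile : profile pl_function n w pl_knot.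
Proof.
split=> //.
- by apply: I01_inj; rewrite val_pl_knot // mul0r.
- by apply: I01_inj; rewrite val_pl_knot // divff // gt_eqF.
- move=> i hi; rewrite !val_pl_knot ?(ltnW hi) // ltr_pM2r ?invr_gt0 //.
  by rewrite ltr_nat.
- move=> i hi; have [hi'|hi'] := ltnP i m.
    rewrite (pl_function_piece hi'); last by rewrite mul_pl_knot // lexx ler_nat leqnSn.
    by rewrite mul_pl_knot // subrr mulr0 addr0.
  (* The last knot starts no piece, so it is evaluated as the right end of the piece before it. *)
  have [j jE] : {j | i = j.+1} by exists i.-1; rewrite /m in hi'; lia.
  have hj : (j < m)%N by rewrite -jE.
  have eM : M * set_val (pl_knot i) = j.+1%:R by rewrite mul_pl_knot // jE.
  rewrite (pl_function_piece hj); last by rewrite eM lexx ler_nat leqnSn.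
  by rewrite eM jE -natr1 addrAC subrr add0r mulr1 subrKC.
- move=> i x y hi; rewrite pl_knot_le ?(ltnW hi) // => ix xy; rewrite pl_knot_ge // => yi.
  have xy' : M * set_val x < M * set_val y by rewrite ltr_pM2l.
  have iy := le_trans ix (ltW xy'); have xi := le_trans (ltW xy') yi.
  rewrite !(pl_function_piece hi) ?ix ?iy ?xi ?yi //.
  have := zigzag_word_at z hi; case: ifP => _ zi.
    by rewrite ltrD2l ltr_nM2l ?ltrD2r // subr_lt0.
  by rewrite ltrD2l ltr_pM2l ?ltrD2r // subr_gt0.
Qed.

Lemma pl_function_piecewise_linear : piecewise_linear pl_function.
Proof.
exists m, (fun i => set_val (pl_knot i)); split.
- by rewrite (profile_first pl_function_profile).
- by rewrite (profile_last pl_function_profile).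
- exact: profile_incr pl_function_profile.
- move=> i hi; set D := word_at w i.+1 - word_at w i.
  exists (D * M), (word_at w i - D * i%:R) => x.
  rewrite pl_knot_le ?(ltnW hi) // pl_knot_ge // => hx.
  by rewrite (pl_function_piece hi hx) -/D mulrBr addrA addrC addrA [RHS]addrA; lra.
Qed.

Lemma pl_function_in_M : in_M pl_function.
Proof.
have pf := pl_function_profile.
split.
- split; first exact: pl_function_continuous.
  exists pl_function; split.
  + exact: pl_function_piecewise_linear.
  + move=> p /(profile_critical pf)[i hi ->]; apply/near_I01.
    have [e e0 h] := knot_near pf hi; exists e => // x /h[h1 h2] /(profile_critical pf)[j hj xE].
    subst x; congr pl_knot; have [ji|ij|//] := ltngtP j i.
      have : set_val (pl_knot j) <= set_val (pl_knot i.-1) by apply: (knot_le pf); lia.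
      by rewrite leNgt h1 // (leq_trans _ ji).
    have : set_val (pl_knot i.+1) <= set_val (pl_knot j) by apply: (knot_le pf); lia.
    by rewrite leNgt h2 // (leq_trans ij).
  + move=> p q /(profile_critical pf)[i hi ->] /(profile_critical pf)[j hj ->].
    rewrite !(profile_val pf) // => e; congr pl_knot.
    exact: (word_at_inj s1 s2 u hi hj e).
  + exact: graph_equiv_refl.
- by have := local_knot pf (leq0n _); rewrite (profile_first pf).
- by have := local_knot pf (leqnn _); rewrite (profile_last pf) odd_double.
Qed.

End PiecewiseLinear.

(** * From Morse-like functions to words *)

Section MorseProfile.
Variable R : realType.
Implicit Types (f g : I01 R -> R) (p x y : I01 R).

(** [s i] marks decreasing pieces; unlike in [profile], neighbouring pieces may go the same way. *)
Record pieces g m (k : nat -> I01 R) (s : nat -> bool) := Pieces {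
  pieces_first : k 0%N = I0 R;
  pieces_last : k m = I1 R;
  pieces_incr : forall i, (i < m)%N -> set_val (k i) < set_val (k i.+1);
  pieces_mono : forall i x y, (i < m)%N -> set_val (k i) <= set_val x ->
    set_val x < set_val y -> set_val y <= set_val (k i.+1) ->
    if s i then g y < g x else g x < g y
}.

Lemma local_min_comp g (phi psi : I01 R -> I01 R) p : continuous psi ->
  cancel phi psi -> cancel psi phi -> local_min (g \o phi) p -> local_min g (phi p).
Proof.
move=> cpsi K K' lm; have lm' : nbhs (psi (phi p)) (fun x => g (phi p) <= g (phi x)).
  by rewrite K.
have /near_I01[e e0 h] := cpsi _ _ lm'.
by apply/near_I01; exists e => // x /h /=; rewrite K'.
Qed.

Lemma constant_local_min g (a c v : R) p : a < set_val p -> set_val p < c ->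
  (forall x, a <= set_val x <= c -> g x = v) -> local_min g p.
Proof.
move=> ap pc gv; apply/near_I01; exists (Order.min (set_val p - a) (c - set_val p)).
  by rewrite lt_min !subr_gt0 ap.
move=> x; rewrite lt_min !ltr_distl => /andP[/andP[h1 h2] /andP[h3 h4]].
by rewrite !gv //; lra.
Qed.

Lemma piecewise_linear_pieces g : piecewise_linear g ->
  (forall p, critical g p -> \forall x \near p, critical g x -> x = p) ->
  exists m k s, pieces g m k s.
Proof.
case=> m [K [K0 Km Kinc Klin]] iso.
have Kle i j : (i <= j <= m)%N -> K i <= K j.
  case/andP=> ij jm; elim: j ij jm => [|j IH]; first by rewrite leqn0 => /eqP ->.
  rewrite leq_eqVlt => /orP[/eqP ->//|ij] jm; apply: le_trans (ltW (Kinc _ jm)).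
  by apply: IH; lia.
have K01 i : (i <= m)%N -> 0 <= K i <= 1 by move=> hi; rewrite -K0 -Km !Kle ?hi ?leqnn.
have vK i : (i <= m)%N -> set_val (clamp (K i)) = K i by move=> hi; apply: val_clamp; exact: K01.
have slope i : (i < m)%N -> exists s : bool, forall x y, K i <= set_val x ->
    set_val x < set_val y -> set_val y <= K i.+1 -> if s then g y < g x else g x < g y.
  move=> hi; have [a [c lin]] := Klin i hi.
  have [a0|a0|a0] := ltgtP a 0.
  - exists true => x y ix xy yi; have xi := le_trans (ltW xy) yi; have iy := le_trans ix (ltW xy).
    by rewrite !lin ?ix ?iy ?xi // ltrD2r ltr_nM2l.
  - exists false => x y ix xy yi; have xi := le_trans (ltW xy) yi; have iy := le_trans ix (ltW xy).
    by rewrite !lin ?ix ?iy ?xi // ltrD2r ltr_pM2l.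
  (* On a piece of slope zero every interior point is critical, so its midpoint would not be
     isolated. *)
  exfalso; subst a.
  have gc x : K i <= set_val x <= K i.+1 -> g x = c by move/lin; rewrite mul0r add0r.
  have /andP[i0 i1] := K01 i (ltnW hi); have /andP[j0 j1] := K01 i.+1 hi.
  have lt := Kinc i hi.
  set p := clamp ((K i + K i.+1) / 2).
  have pE : set_val p = (K i + K i.+1) / 2 by rewrite val_clamp //; lra.
  have pK : set_val p < K i.+1 by rewrite pE; lra.
  have Kp : K i < set_val p by rewrite pE; lra.
  have /iso/near_I01[e e0 h] : critical g p by left; exact: constant_local_min Kp pK gc.
  have e'0 : 0 < Order.min e (K i.+1 - set_val p) by rewrite lt_min e0 subr_gt0.
  have [x [px xK]] := approach_right j1 pK e'0.
  rewrite lt_min => /andP[/h hx]; rewrite ltr_distl => /andP[_ hx'].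
  have xp : x = p.
    apply: hx; left; apply: (constant_local_min (a:=K i) (c:=K i.+1) _ _ gc).
      exact: lt_trans px.
    by lra.
  by move: px; rewrite xp ltxx.
have slope' i : exists s : bool, (i < m)%N -> forall x y, K i <= set_val x ->
    set_val x < set_val y -> set_val y <= K i.+1 -> if s then g y < g x else g x < g y.
  have [hi|hi] := ltnP i m; last by exists true.
  by have [s hs] := slope i hi; exists s.
have [s hs] := choice slope'.
exists m, (fun i => clamp (K i)), s; split => /=.
- by apply: I01_inj; rewrite vK // K0.
- by apply: I01_inj; rewrite vK // Km.
- by move=> i hi; rewrite !vK ?(ltnW hi) //; apply: Kinc.
- by move=> i x y hi; rewrite !vK ?(ltnW hi) //; apply: hs.
Qed.

Lemma pieces_merge g m k s i : pieces g m k s -> (i.+1 < m)%N -> s i = s i.+1 ->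
  exists k' s', pieces g m.-1 k' s'.
Proof.
move=> pc hi si.
exists (fun j => if (j <= i)%N then k j else k j.+1),
  (fun j => if (j <= i)%N then s j else s j.+1); split.
- by rewrite leq0n (pieces_first pc).
- by rewrite ifF ?prednK ?(pieces_last pc) //; lia.
- move=> j hj; have [ji|ij|->] := ltngtP j i.
  + by apply: (pieces_incr pc); lia.
  + by apply: (pieces_incr pc); lia.
  + by apply: (lt_trans (pieces_incr pc _) (pieces_incr pc _)); lia.
- move=> j x y hj; have [ji|ij|->] := ltngtP j i.
  + by apply: (pieces_mono pc); lia.
  + by apply: (pieces_mono pc); lia.
  + move=> ix xy yi; have i1 : (i < m)%N by lia.
    have [yk|ky] := leP (set_val y) (set_val (k i.+1)).
      exact: (pieces_mono pc) i1 ix xy yk.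
    have [kx|xk] := leP (set_val (k i.+1)) (set_val x).
      by rewrite si; apply: (pieces_mono pc hi kx xy yi).
    have := pieces_mono pc i1 ix xk (lexx _).
    have := pieces_mono pc hi (lexx _) ky yi.
    by rewrite -si; case: ifP => _ h1 h2; [exact: lt_trans h1 h2|exact: lt_trans h2 h1].
Qed.

(** In a decomposition with the fewest pieces, two neighbours in the same direction could still be
    merged. *)
Lemma alternating_pieces g : (exists m k s, pieces g m k s) ->
  exists m k s, pieces g m k s /\ forall i, (i.+1 < m)%N -> s i.+1 = ~~ s i.
Proof.
move=> ex.
have ex' : exists m, `[< exists k s, pieces g m k s >].
  by have [m [k [s pc]]] := ex; exists m; apply/asboolP; exists k, s.
have [m /asboolP[k [s pc]] mn] := ex_minnP ex'.
exists m, k, s; split => // i hi.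
case: (eqVneq (s i) (s i.+1)) => [e|]; last by case: (s i); case: (s i.+1).
have [k' [s' pc']] := pieces_merge pc hi e.
have := mn m.-1 ltac:(by apply/asboolP; exists k', s'); lia.
Qed.

(** The local minimum at 0 makes the first piece increasing and the one at 1 makes the last
    decreasing, so the alternating pieces are even in number. Distinctness of the letters comes from
    distinct critical values. *)
Lemma in_M_profile f : in_M f ->
  exists n w k, profile f n w k /\ uniq (w.1 ++ w.2).
Proof.
case=> [[cf [g [plg iso dist [phi hphi fE]]]] lm0 lm1].
have [psi [K K' hpsi]] := increasing_homeo_inv hphi.
have cpsi : continuous psi by case: hpsi => ? [].
have [p0 p1] := homeo_bounds hphi.
have lg0 : local_min g (I0 R) by rewrite -p0; apply: (local_min_comp cpsi K K'); rewrite -fE.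
have lg1 : local_min g (I1 R) by rewrite -p1; apply: (local_min_comp cpsi K K'); rewrite -fE.
have [m [k [s [pc alt]]]] := alternating_pieces (piecewise_linear_pieces plg iso).
have m0 : (0 < m)%N.
  case: (posnP m) (pieces_last pc) => // ->; rewrite (pieces_first pc) => e.
  by have := congr1 set_val e => /= /eqP; rewrite eq_sym oner_eq0.
have s0 : s 0%N = false.
  apply/negbTE/negP => s0; have /near_I01[e e0 h] := lg0.
  have lt := pieces_incr pc m0; have /andP[_ k1] := I01_bounds (k 1%N).
  have lt' : set_val (I0 R) < set_val (k 1%N) by rewrite -(pieces_first pc).
  have [x [hx xk hxe]] := approach_right k1 lt' e0.
  have := pieces_mono pc m0 (x:=I0 R) (y:=x); rewrite s0 (pieces_first pc) lexx.
  by move=> /(_ isT hx xk); rewrite ltNge h.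
have sl : s m.-1 = true.
  apply/negPn/negP => /negbTE sl; have /near_I01[e e0 h] := lg1.
  have m1 : (m.-1 < m)%N by lia.
  have lt := pieces_incr pc m1; have /andP[k0 _] := I01_bounds (k m.-1).
  have lt' : set_val (k m.-1) < set_val (I1 R) by rewrite -(pieces_last pc) -{2}(prednK m0).
  have [x [xk hx hxe]] := approach_left k0 lt' e0.
  have := pieces_mono pc m1 (x:=x) (y:=I1 R); rewrite sl prednK // (pieces_last pc) lexx.
  by move=> /(_ xk hx isT); rewrite ltNge h.
have sE i : (i < m)%N -> s i = odd i.
  elim: i => [|i IH] hi; first by rewrite s0.
  by rewrite alt // IH // ltnW.
pose n := m./2; have mE : m = n.*2.
  have := odd_double_half m; rewrite -/n; have := sE m.-1 ltac:(lia).
  by rewrite sl -{2}(prednK m0) /= => <-.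
pose w := ([seq g (k i.*2) | i <- iota 0 n.+1], [seq g (k i.*2.+1) | i <- iota 0 n]).
have pf : profile g n w k.
  split.
  - by rewrite size_map size_iota.
  - by rewrite size_map size_iota.
  - exact: pieces_first pc.
  - by rewrite -mE (pieces_last pc).
  - by rewrite -mE; exact: pieces_incr pc.
  - move=> i hi; have iE := odd_double_half i; rewrite /word_at.
    case: (odd i) iE => iE; rewrite (nth_map 0%N) ?size_iota ?nth_iota; try by move: hi iE; clear; lia.
      by rewrite add0n -{1}iE.
    by rewrite add0n -{1}iE.
  - by rewrite -mE => i x y hi; have := @pieces_mono _ _ _ _ pc i x y hi; rewrite sE.
exists n, w, (psi \o k); split.
  by rewrite fE; apply: profile_comp.
have -> : w.1 ++ w.2 = [seq g (k i) | i <- [seq i.*2 | i <- iota 0 n.+1] ++ [seq i.*2.+1 | i <- iota 0 n]].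
  by rewrite map_cat -!map_comp.
set L := _ ++ _.
have Lm i : i \in L -> (i <= n.*2)%N.
  by rewrite mem_cat => /orP[] /mapP[j]; rewrite mem_iota => hj ->; lia.
rewrite map_inj_in_uniq => [|i j /Lm hi /Lm hj e].
  rewrite cat_uniq !map_inj_uniq ?iota_uniq ?andbT /=; last 2 first.
  - by move=> i j []; exact: double_inj.
  - exact: double_inj.
  apply/hasPn => x /mapP[j _ ->]; apply/mapP => -[i _]; lia.
apply: (knot_inj pf) => //; apply: dist => //; apply/(profile_critical pf).
  by exists i.
by exists j.
Qed.

End MorseProfile.

(** * Barcodes and the count *)

Section Bars.
Variable R : realType.
Implicit Types (b d : nat -> R) (n : nat) (J K L : set R).

(* J reaches further right than K; along this strict order the bars are sorted
   by decreasing death. *)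
Definition outlasts J K : bool := `[< exists2 x, J x & forall y, K y -> y < x >].

Lemma outlasts_irr : irreflexive outlasts.
Proof. by move=> J; apply/asboolP => -[x Jx h]; have := h x Jx; rewrite ltxx. Qed.

Lemma outlasts_trans : transitive outlasts.
Proof.
move=> K J L /asboolP[x Jx h] /asboolP[y Ky h']; apply/asboolP; exists x => // z /h' zy.
exact: lt_trans zy (h _ Ky).
Qed.

Lemma mem_bar b d j x : bar b d j x <-> b j <= x /\ ((0 < j)%N -> x < d j).
Proof.
rewrite /bar; case: (posnP j) => [->|j0].
  by rewrite /= in_itv /= andbT; split=> [|[]].
rewrite /= in_itv /=; split=> [/andP[h1 h2]|[h1 h2]]; first by split.
by rewrite h1 h2.
Qed.

Lemma bar_birth b d n j : bars_ok b d n -> (j <= n)%N -> bar b d j (b j).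
Proof.
move=> ok hj; apply/mem_bar; split => // j0.
by apply: (birth_lt_death ok); rewrite j0.
Qed.

Lemma bar_outlasts b d n i j : bars_ok b d n -> (i < j <= n)%N ->
  outlasts (bar b d i) (bar b d j).
Proof.
(* The death of j is a time when bar i is alive, unless i is born after it; then the birth of i
   serves. *)
move=> ok hij; apply/asboolP; exists (Order.max (b i) (d j)).
  apply/mem_bar; split; first by rewrite le_max lexx.
  move=> i0; rewrite gt_max (birth_lt_death ok) ?(deaths_decr ok) //; lia.
move=> y /mem_bar[_ hy]; rewrite lt_max hy ?orbT //; lia.
Qed.

Lemma bars_sorted b d n : bars_ok b d n ->
  sorted outlasts [seq bar b d k | k <- iota 0 n.+1].
Proof.
move=> ok; apply: (path.homo_sorted_in (e:=ltn) (P:=[pred i | (i <= n)%N])).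
- by move=> i j hi hj ij; apply: (@bar_outlasts b d n i j ok); apply/andP.
- by apply/allP => i; rewrite mem_iota inE; lia.
- exact: iota_ltn_sorted.
Qed.

Lemma bars_uniq b d n : bars_ok b d n -> uniq [seq bar b d k | k <- iota 0 n.+1].
Proof.
move=> ok; apply: sorted_uniq (bars_sorted ok); [exact: outlasts_trans|exact: outlasts_irr].
Qed.

(** A list sorted for the strict order [outlasts] is determined by its members, and the ends of each
    bar are then its birth and death. *)
Lemma bars_determined b d n b' d' n' : bars_ok b d n -> bars_ok b' d' n' ->
  [seq bar b d k | k <- iota 0 n.+1] =i [seq bar b' d' k | k <- iota 0 n'.+1] ->
  n = n' /\ forall k, (k <= n)%N -> b k = b' k /\ ((0 < k)%N -> d k = d' k).
Proof.
move=> ok ok' mem.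
have e := irr_sorted_eq outlasts_trans outlasts_irr (bars_sorted ok) (bars_sorted ok') mem.
have en : n = n' by have := congr1 size e; rewrite !size_map !size_iota => -[].
subst n'; split => // k hk.
have eb : bar b d k = bar b' d' k.
  have := congr1 (fun s => nth set0 s k) e.
  by rewrite !(nth_map 0%N) ?size_iota // !nth_iota // !add0n; apply.
have bk : b k = b' k.
  apply/le_anti/andP; split.
    by have := bar_birth ok' hk; rewrite -eb => /mem_bar[].
  by have := bar_birth ok hk; rewrite eb => /mem_bar[].
split=> // k0; have bd : b k < d k by apply: (birth_lt_death ok); rewrite k0.
have bd' : b' k < d' k by apply: (birth_lt_death ok'); rewrite k0.
have [lt|lt|//] := ltgtP (d k) (d' k).
- have : bar b' d' k (d k) by apply/mem_bar; split => //; rewrite -bk ltW.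
  by rewrite -eb => /mem_bar[_ /(_ k0)]; rewrite ltxx.
- have : bar b d k (d' k) by apply/mem_bar; split => //; rewrite bk ltW.
  by rewrite eb => /mem_bar[_ /(_ k0)]; rewrite ltxx.
Qed.

(** Deaths decrease with the index, so the right ends compare as the indices do, and the births
    decide on the left. Thus the bars counted by [mu] are the hosts in [sites]. *)
Lemma bar_proper b d n j k : bars_ok b d n -> (0 < j <= n)%N -> (k <= n)%N ->
  bar b d j `<` bar b d k <-> (k < j)%N && (b k < b j).
Proof.
move=> ok hj hk; have jn : (j <= n)%N by lia.
split=> [[sub nsub]|/andP[kj bkj]].
  have /mem_bar[bkj _] := sub _ (bar_birth ok jn).
  have kj : (k < j)%N.
    rewrite ltnNge leq_eqVlt; apply/negP => /orP[/eqP jk|jk].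
      by apply: nsub; rewrite jk.
    have /asboolP[x jx hx] := bar_outlasts ok (i:=j) (j:=k) ltac:(by rewrite jk hk).
    by have := hx x (sub _ jx); rewrite ltxx.
  rewrite kj lt_neqAle bkj andbT; apply/eqP => e.
  by have := births_inj ok hk jn e; lia.
split=> [x /mem_bar[bx xd]|sub].
  apply/mem_bar; split; first exact: le_trans (ltW bkj) bx.
  move=> k0; apply: lt_trans (xd _) _; first by lia.
  by apply: (deaths_decr ok); lia.
by have /mem_bar[] := sub _ (bar_birth ok hk); rewrite leNgt bkj.
Qed.

Lemma mu_bar b d n (B : barcode R) j : bars_ok b d n ->
  (forall J, B J = count_mem J [seq bar b d k | k <- iota 0 n.+1]) -> (0 < j <= n)%N ->
  mu B (bar b d j) = count (fun k => b k < b j)%R (iota 0 j).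
Proof.
move=> ok hB hj; set L := [seq bar b d k | k <- iota 0 n.+1].
have uL : uniq L by exact: bars_uniq.
pose P K := `[< bar b d j `<` K >].
rewrite /mu (fsbigE [seq K <- L | P K]).
- transitivity (\sum_(K <- [seq K <- L | P K]) 1)%N.
    rewrite [LHS]big_seq_cond [RHS]big_seq; apply: eq_big => [K|K /andP[]].
      apply: andb_idr; rewrite mem_filter => /andP[/asboolP PK _]; exact: mem_set.
    by rewrite mem_filter => /andP[_ KL] _; rewrite hB count_uniq_mem // KL.
  rewrite sum1_size size_filter /L count_map.
  (* Bars of index at least j do not strictly contain bar j, so only the first j indices count. *)
  have -> : n.+1 = (j + (n.+1 - j))%N by lia.
  rewrite iotaD count_cat add0n addnC (_ : count _ (iota j _) = 0%N).
    apply: eq_in_count => k; rewrite mem_iota add0n => /andP[_ kj] /=.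
    have kn : (k <= n)%N by apply: leq_trans (ltnW kj) _; case/andP: hj.
    by apply/asboolP/idP => [/(bar_proper ok hj kn)/andP[]//|h]; apply/(bar_proper ok hj kn)/andP.
  apply/eqP; rewrite -leqn0 leqNgt -has_count; apply/hasPn => k.
  rewrite mem_iota => /andP[jk kn]; apply/asboolP.
  have {}kn : (k <= n)%N by rewrite -ltnS; apply: leq_trans kn _; rewrite subnKC // ltnW //; case/andP: hj.
  by move=> /(bar_proper ok hj kn); rewrite ltnNge jk.
- exact: filter_uniq.
- move=> K KL; have : K \in [seq K <- L | P K] := KL.
  by rewrite mem_filter => /andP[/asboolP].
- move=> K PK; rewrite mem_filter negb_and => /orP[/asboolP//|nK].
  by rewrite hB; apply/count_memPn.
Qed.

End Bars.

(** * Labels of the chiral tree and the barcode of a function with a given word *)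

Section Fibers.
Variable R : realType.
Implicit Types (f : I01 R -> R) (B : barcode R).

Lemma card_le2_distinct (T : Type) (A : set T) k x y z : A #= `I_k -> (k <= 2)%N ->
  A x -> A y -> A z -> x <> y -> y <> z -> x <> z -> False.
Proof.
move=> /card_set_bijP[g [gk inj _]] k2 Ax Ay Az xy yz xz.
have neq u v : A u -> A v -> u <> v -> g u <> g v.
  by move=> Au Av uv e; apply: uv; apply: inj; rewrite ?inE.
have := neq _ _ Ax Ay xy; have := neq _ _ Ay Az yz; have := neq _ _ Ax Az xz.
have := gk _ Ax; have := gk _ Ay; have := gk _ Az => /=; lia.
Qed.

(** If x' were not to the left of y', the segments from x to x' and from y to y' would cover the one
    from x to y and join the components. *)
Lemma components_left_of f t x y : f x <= t -> f y <= t ->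
  path_component R (sublevel f t) x <> path_component R (sublevel f t) y ->
  set_val x < set_val y ->
  left_of (path_component R (sublevel f t) x) (path_component R (sublevel f t) y).
Proof.
move=> fx fy ne xy x' y' /path_in_sublevel hx /path_in_sublevel hy.
rewrite ltNge; apply/negP => yx; apply: ne; apply/component_eq => // z hz.
have {}hz : set_val x <= set_val z <= set_val y by case/orP: hz => // hz; lra.
have [zx|xz] := leP (set_val z) (set_val x').
  by apply: hx; apply/orP; left; case/andP: hz => ->.
apply: hy; apply/orP; right; case/andP: hz => _ ->; rewrite andbT.
exact: le_trans yx (ltW xz).
Qed.

Lemma stages_left_of f t C D : stage (pi0_sublevel f) t C -> stage (pi0_sublevel f) t D ->
  C <> D -> left_of C D \/ left_of D C.
Proof.
move=> [x fx <-] [y fy <-] ne.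
have [xy|yx|/I01_inj e] := ltgtP (set_val x) (set_val y).
- by left; apply: components_left_of.
- by right; apply: components_left_of => //; exact: nesym.
- by rewrite e in ne.
Qed.

Lemma stage_nonempty f t C : stage (pi0_sublevel f) t C -> exists x, C x.
Proof. by move=> [x fx <-]; exists x; apply/path_in_sublevel/below_between_refl. Qed.

Lemma left_of_irr (C D : set (I01 R)) x : C x -> left_of C D -> C <> D.
Proof. by move=> Cx lCD e; have := lCD x x Cx; rewrite -e ltxx => /(_ Cx). Qed.

(** A component is labelled L when it merges with one on its right. *)
Lemma Psi_exists f (S : morse_set R (set (I01 R))) : ms_pset S = pi0_sublevel f ->
  exists X, ch_morse X = S /\ Psi f X.
Proof.
move=> SE; pose T := nth 0 (ms_times S).
pose label i C := `[< exists D, [/\ stage S (T i) D, left_of C D &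
  Defs.shift S (T i) (T i.+1) C = Defs.shift S (T i) (T i.+1) D] >].
have lab i C D : (i.+1 < size (ms_times S))%N -> stage S (T i) C -> stage S (T i) D ->
    left_of C D -> Defs.shift S (T i) (T i.+1) C = Defs.shift S (T i) (T i.+1) D ->
    label i C /\ ~~ label i D.
  move=> hi hC hD CD e; split; first by apply/asboolP; exists D.
  (* If D also merged with some E on its right, then C, D and E would be three points of one
     fibre. *)
  apply/asboolP => -[E [hE DE e']].
  have [F _ mt _] := ms_axioms S.
  have hx : stage S (T i.+1) (Defs.shift S (T i) (T i.+1) C).
    have [h _ _] := F; apply: h => //; apply/ltW.
    have [_ [srt _]] := mt.
    by rewrite /T (lt_sorted_ltn_nth 0 (s:=ms_times S)) // inE // ltnW.
  have [_ [_ [_ [_ [_ [fib _]]]]]] := mt.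
  have [k k2 ck] := fib i _ hi hx.
  have ne U (hU : stage S (T i) U) V : left_of U V -> U <> V.
    by move: hU; rewrite SE => /stage_nonempty[x Ux]; exact: left_of_irr Ux.
  have [y Dy] : exists y, D y by move: hD; rewrite SE => /stage_nonempty.
  have CE : left_of C E.
    by move=> u v Cu Ev; apply: lt_trans (CD _ _ Cu Dy) (DE _ _ Dy Ev).
  apply: (card_le2_distinct ck k2 (x:=C) (y:=D) (z:=E)) => //=.
  - by split => //; rewrite -e' -e.
  - exact: ne CD.
  - exact: ne DE.
  - exact: ne CE.
have ax i C D : let T' := nth 0 (ms_times S) in (i.+1 < size (ms_times S))%N ->
    stage S (T' i) C -> stage S (T' i) D -> C <> D ->
    Defs.shift S (T' i) (T' i.+1) C = Defs.shift S (T' i) (T' i.+1) D ->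
    label i C != label i D.
  move=> T' hi hC hD ne e.
  have [CD|DC] : left_of C D \/ left_of D C.
    by move: hC hD; rewrite SE => hC hD; exact: stages_left_of hC hD ne.
  - by have [-> /negbTE ->] := lab i C D hi hC hD CD e.
  - by have [-> /negbTE ->] := lab i D C hi hD hC DC (esym e).
exists (ChiralTree (ch_morse:=S) (ch_left:=label) ax); split => //.
Qed.

(** The sublevel functor of f and that of its merge tree are presented by the same [rep], and
    [Elder] runs on the latter; the labels do not affect the outcome. *)
Lemma PH0_profile f n w k b d B : bars_ok b d n -> w \in words b d n -> profile f n w k ->
  PH0 f B <-> forall J, B J = count_mem J [seq bar b d k | k <- iota 0 n.+1].
Proof.
move=> ok hw pf; have [rep ec] := elder_words ok hw; have [el _] := ec.
have pr := presented_profile ok hw ec pf.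
split=> [[X [XE _] [_ [S SE run]]]|hB].
  have prX := pr; rewrite -XE in prX; have prT := presented_tree prX.
  have {}prT : presented b n rep S (fun t j => [set q | tree_height q <= t /\
      tree_level t q = path_component R (sublevel f t) (min_knot b w k j)]).
    by rewrite SE.
  exact/(elder_rule_presented B ok el prT).
pose S := MorseSet (presented_morse_axioms ok el pr).
have [X [XE psi]] := Psi_exists (S:=S) erefl.
exists X => //.
have prX := pr; rewrite -[pi0_sublevel f]/(ms_pset S) -XE in prX.
have prT := presented_tree prX.
pose S' := MorseSet (presented_morse_axioms ok el prT).
split; first by exists (set (I01 R) : choiceType), (ch_morse X); exact: iso_over_refl.
by exists S' => //; apply/(elder_rule_presented (S:=S') B ok el prT).
Qed.

End Fibers.

Theorem theorem6p12 (R : realType) (N : nat) (b d : nat -> R)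
    (I : nat -> set R) (B : barcode R)
    (hN : (2 <= N)%N)
    (hB : forall J : set R, B J = count_mem J [seq I j | j <- iota 1 N])
    (hI1 : I 1%N = `[b 1%N, +oo[%classic)
    (hI : forall j, (2 <= j <= N)%N -> b j < d j /\ I j = `[b j, d j[%classic)
    (hsub : forall j, (2 <= j <= N)%N -> I j `<=` I 1%N)
    (hd : forall j, (2 <= j)%N -> (j < N)%N -> d j.+1 < d j)
    (hb : forall j k, (1 <= j <= N)%N -> (1 <= k <= N)%N -> j <> k ->
       b j <> b k)
    (hbd : forall j k, (1 <= j <= N)%N -> (2 <= k <= N)%N -> b j <> d k) :
  PH0_fiber B #= `I_(2 ^ (N - 1) * \prod_(2 <= j < N.+1) mu B (I j)).
Proof.
have [n NE] : exists n, N = n.+1 by exists N.-1; lia.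
subst N; have n0 : (0 < n)%N by lia.
pose b' j := b j.+1; pose d' j := d j.+1.
have dd i j : (2 <= i)%N -> (i < j <= n.+1)%N -> d j < d i.
  move=> i2; elim: j => // j IH; rewrite ltnS leq_eqVlt => /andP[/orP[/eqP <-|ij] jn].
    exact: hd.
  by apply: (lt_trans (hd j _ _)); [lia|lia|apply: IH; lia].
have ok : bars_ok b' d' n.
  split.
  - move=> i j hi hj e; apply: contrapT => ne; apply: (hb i.+1 j.+1) => //; lia.
  - by move=> i hi; have [] := hI i.+1 ltac:(lia).
  - by move=> i j hi hij; apply: dd; lia.
  - by move=> i j hi hj; apply: hbd; lia.
have IE j : (j <= n)%N -> I j.+1 = bar b' d' j.
  rewrite /bar; case: (posnP j) => [->|j0] jn; first by rewrite hI1.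
  by have [] := hI j.+1 ltac:(lia).
have hB' J : B J = count_mem J [seq bar b' d' k | k <- iota 0 n.+1].
  rewrite hB -[1%N]addn0 iotaDl -map_comp; congr (count_mem J).
  by apply/eq_in_map => j; rewrite mem_iota => /andP[_ hj] /=; apply: IE.
have -> : (2 ^ (n.+1 - 1) * \prod_(2 <= j < n.+2) mu B (I j))%N = size (words b' d' n).
  rewrite size_words subn1 /=; congr (_ * _)%N; rewrite big_add1 /=.
  apply: eq_big_nat => j hj; rewrite IE ?(mu_bar ok hB') //; lia.
set W := words b' d' n.
have uW : uniq W by exact: words_uniq.
have plP w : w \in W -> profile (pl_function n w) n w (pl_knot R n) /\ in_M (pl_function n w).
  move=> hw; have z := zigzag_words ok hw; have u := uniq_words ok hw.
  have s1 := size_words1 hw; have s2 := size_words2 hw.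
  by split; [apply: pl_function_profile|apply: pl_function_in_M].
apply: card_esym; apply/card_set_bijP.
(* Each word is sent to the class of its piecewise linear model. *)
exists (fun i => graph_class (pl_function n (nth ([::], [::]) W i))); split.
- move=> i /= hi; have hw := mem_nth ([::], [::]) hi.
  have [pf fM] := plP _ hw.
  by exists (pl_function n (nth ([::], [::]) W i)); split => //; apply/(PH0_profile B ok hw pf).
(* Reparametrizing moves the knots but keeps the word, so equivalent models have equal words, and
   [W] has no repetition. *)
- move=> i j; rewrite !inE /= => hi hj /graph_classP[phi hphi fE].
  have [pi _] := plP _ (mem_nth ([::], [::]) hi).
  have [pj _] := plP _ (mem_nth ([::], [::]) hj).
  have [psi [K K' hpsi]] := increasing_homeo_inv hphi.
  have := profile_comp pj hpsi K K'; rewrite -fE => pj'.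
  have [_ e] := profile_uniq pi pj'.
  by apply/eqP; rewrite -(nth_uniq ([::], [::]) hi hj uW) e.
(* The word of f belongs to some bars [b2], [d2]. They have the barcode B, so they are the given
   ones and the word is in [W]; f is then equivalent to its model. *)
- move=> c [f [fM ph ->]].
  have [m [w [k [pf u]]]] := in_M_profile fM.
  have [b2 [d2 [ok2 hw2]]] := zigzag_is_word (profile_size1 pf) (profile_size2 pf) u (profile_zigzag pf).
  have hB2 := (PH0_profile B ok2 hw2 pf).1 ph.
  have [|mn ext] := bars_determined ok ok2.
    by move=> J; rewrite -!has_pred1 !has_count -hB' -hB2.
  subst m.
  have hw : w \in W.
    rewrite /W (words_ext (b':=b2) (d':=d2)) //.
      by move=> i hi; have [] := ext i hi.
    by move=> i /andP[i0 hi]; have [_] := ext i hi; apply.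
  exists (index w W); rewrite /= ?index_mem ?nth_index //.
  have [pf' [[cf' _] _ _]] := plP _ hw.
  have [[cf _] _ _] := fM.
  by apply/graph_classP; exact: profile_graph_equiv pf' pf.
Qed.
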